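(* Let $A$ be a stably coherent ring and assume that its weak global dimension is finite. Then, for every $n\geq 0$, the polynomial ring $A[X_1,\dots,X_n]$ is locally HMCM. In particular, $A[X_1,\dots,X_n]$ is HMCM.
   Context: All rings are commutative with identity. A ring is coherent if every finitely generated ideal is finitely presented; $A$ is stably coherent if $A$ is coherent and $A[X_1,\dots,X_n]$ is coherent for every positive integer $n$. The weak global dimension of $A$ is the supremum of the flat dimensions of all $A$-modules. Weakly proregular sequences: for a ring $R$, $\underline{a}=a_1,\dots,a_r\in R$ and $n\geq 0$ write $\underline{a}^n=a_1^n,\dots,a_r^n$ and let $H_i(\underline{a}^n)$ be the $i$-th Koszul homology of $\underline{a}^n$ on $R$. For $m\geq n$ there is a natural map $\varphi_{mn}\colon H_i(\underline{a}^m)\to H_i(\underline{a}^n)$ induced by the tensor product over $j$ of the chain maps $K_\bullet(a_j^m)\to K_\bullet(a_j^n)$ which are the identity in degree $0$ and multiplication by $a_j^{m-n}$ in degree $1$. The sequence $\underline{a}$ is weakly proregular if for every $1\leq i\leq r$ and every $n\geq 0$ there is $m\geq n$ with $\varphi_{mn}=0$. Parameter sequences: $\underline{a}=a_1,\dots,a_r$ is a parameter sequence if (1) it is weakly proregular; (2) $\underline{a}R\neq R$; (3) for every prime ideal $P$ containing $\underline{a}$, $\check{H}^r(\underline{a},R)_P\neq 0$, where $\check{H}^r(\underline{a},R)$ is the $r$-th cohomology of the Čech complex of $\underline{a}$ on $R$. It is a strong parameter sequence if $a_1,\dots,a_i$ is a parameter sequence for every $i=1,\dots,r$. HMCM: $R$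 is HMCM (Cohen–Macaulay in the sense of Hamilton–Marley) if every strong parameter sequence of $R$ is a regular sequence on $R$ (each $a_i$ is a non-zero-divisor on $R/(a_1,\dots,a_{i-1})R$, and $R/\underline{a}R\neq 0$). $R$ is locally HMCM if $R_P$ is HMCM for every prime ideal $P$ of $R$. *)

(* Defs.v *)
From HB Require Import structures.
From mathcomp Require Import all_boot all_order all_algebra.
From mathcomp Require Import generic_quotient ring_quotient.
From mathcomp Require Import boolp.
From mathcomp Require Import mpoly.
From mathcomp Require Import ring.

Set Implicit Arguments.
Unset Strict Implicit.
Unset Printing Implicit Defensive.
Import GRing.Theory.
Local Open Scope ring_scope.
Local Open Scope quotient_scope.

(* A premodule is a set with operations that satisfy the axioms of an
   R-module up to an equivalence relation; qmod is its quotient. *)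
Record premodule (R : pzRingType) := Premodule {
  psort :> choiceType;
  pzero : psort;
  popp : psort -> psort;
  padd : psort -> psort -> psort;
  pscale : R -> psort -> psort;
  peqv : rel psort;
  peqv_equiv : equiv_class_of peqv;
  peqv_opp : forall x x', peqv x x' -> peqv (popp x) (popp x');
  peqv_add : forall x x' y y',
    peqv x x' -> peqv y y' -> peqv (padd x y) (padd x' y');
  peqv_scale : forall a x x', peqv x x' -> peqv (pscale a x) (pscale a x');
  paddA : forall x y z, peqv (padd x (padd y z)) (padd (padd x y) z);
  paddC : forall x y, peqv (padd x y) (padd y x);
  padd0 : forall x, peqv (padd pzero x) x;
  paddN : forall x, peqv (padd (popp x) x) pzero;
  pscaleA : forall a b x, peqv (pscale a (pscale b x)) (pscale (a * b) x);
  pscale1 : forall x, peqv (pscale 1 x) x;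
  pscaleDr : forall a x y,
    peqv (pscale a (padd x y)) (padd (pscale a x) (pscale a y));
  pscaleDl : forall x a b,
    peqv (pscale (a + b) x) (padd (pscale a x) (pscale b x))
}.

Section QuotientOfPremodule.
Variables (R : pzRingType) (T : premodule R).

Canonical peqv_equiv_rel := EquivRelPack (peqv_equiv T).
Canonical peqv_encModRel := defaultEncModRel (@peqv R T).

Definition qmod := {eq_quot @peqv R T}.
HB.instance Definition _ := Choice.on qmod.
HB.instance Definition _ := EqQuotient.on qmod.

Definition qcls (x : T) : qmod := \pi_qmod x.

Lemma qcls_eq x y : (qcls x == qcls y) = peqv x y.
Proof. by rewrite /qcls piE. Qed.

Lemma qclsP x y : reflect (qcls x = qcls y) (peqv x y).
Proof. by rewrite -qcls_eq; apply: eqP. Qed.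

Lemma peqv_repr x : peqv (repr (qcls x)) x.
Proof. by apply/qclsP; rewrite /qcls reprK. Qed.

Lemma qcls_repr (x : qmod) : qcls (repr x) = x.
Proof. by rewrite /qcls reprK. Qed.

Definition qzero : qmod := qcls (pzero T).
Definition qopp (x : qmod) : qmod := qcls (popp (repr x)).
Definition qadd (x y : qmod) : qmod := qcls (padd (repr x) (repr y)).
Definition qscale a (x : qmod) : qmod := qcls (pscale a (repr x)).

Lemma qoppE x : qopp (qcls x) = qcls (popp x).
Proof. exact/qclsP/peqv_opp/peqv_repr. Qed.
Lemma qaddE x y : qadd (qcls x) (qcls y) = qcls (padd x y).
Proof. by apply/qclsP/peqv_add; apply: peqv_repr. Qed.
Lemma qscaleE a x : qscale a (qcls x) = qcls (pscale a x).
Proof. exact/qclsP/peqv_scale/peqv_repr. Qed.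

Lemma qaddA : associative qadd.
Proof.
move=> x y z; rewrite -(qcls_repr x) -(qcls_repr y) -(qcls_repr z) !qaddE.
exact/qclsP/paddA.
Qed.
Lemma qaddC : commutative qadd.
Proof.
move=> x y; rewrite -(qcls_repr x) -(qcls_repr y) !qaddE.
exact/qclsP/paddC.
Qed.
Lemma qadd0 : left_id qzero qadd.
Proof. move=> x; rewrite -(qcls_repr x) qaddE; exact/qclsP/padd0. Qed.
Lemma qaddN : left_inverse qzero qopp qadd.
Proof. move=> x; rewrite -(qcls_repr x) qoppE qaddE; exact/qclsP/paddN. Qed.

HB.instance Definition _ :=
  GRing.isZmodule.Build qmod qaddA qaddC qadd0 qaddN.

Lemma qscaleA a b x : qscale a (qscale b x) = qscale (a * b) x.
Proof. rewrite -(qcls_repr x) !qscaleE; exact/qclsP/pscaleA. Qed.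
Lemma qscale1 : left_id 1 qscale.
Proof. move=> x; rewrite -(qcls_repr x) qscaleE; exact/qclsP/pscale1. Qed.
Lemma qscaleDr : right_distributive qscale +%R.
Proof.
move=> a x y; rewrite -(qcls_repr x) -(qcls_repr y).
rewrite /GRing.add /= !(qaddE, qscaleE); exact/qclsP/pscaleDr.
Qed.
Lemma qscaleDl x : {morph qscale^~ x : a b / a + b >-> a + b}.
Proof.
move=> a b; rewrite -(qcls_repr x) [RHS]/GRing.add /= !(qaddE, qscaleE).
exact/qclsP/pscaleDl.
Qed.

HB.instance Definition _ :=
  GRing.Zmodule_isLmodule.Build R qmod qscaleA qscale1 qscaleDr qscaleDl.

Lemma qcls0 : qcls (pzero T) = 0. Proof. by []. Qed.
Lemma qclsN x : qcls (popp x) = - qcls x.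
Proof. by rewrite /GRing.opp /= qoppE. Qed.
Lemma qclsD x y : qcls (padd x y) = qcls x + qcls y.
Proof. by rewrite /GRing.add /= qaddE. Qed.
Lemma qclsZ a x : qcls (pscale a x) = a *: qcls x.
Proof. by rewrite /GRing.scale /= qscaleE. Qed.

End QuotientOfPremodule.

(* subquot Z B is the module Z / (Z :&: B), for submodules Z and B of M. *)
Section Subquotient.
Variables (R : pzRingType) (M : lmodType R) (Z B : submodClosed M).

Lemma submod_rpredN (x : M) : x \in Z -> - x \in Z.
Proof. by move=> xZ; rewrite -scaleN1r rpredZ. Qed.

Lemma submod_rpredZ a (x : M) : x \in Z -> a *: x \in Z.
Proof. exact: rpredZ. Qed.

Local Notation carrier := {x : M | x \in Z}.

Definition sq_zero : carrier := exist _ 0 (rpred0 Z).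
Definition sq_opp (x : carrier) : carrier :=
  exist _ (- val x) (submod_rpredN (valP x)).
Definition sq_add (x y : carrier) : carrier :=
  exist _ (val x + val y) (rpredD (valP x) (valP y)).
Definition sq_scale a (x : carrier) : carrier :=
  exist _ (a *: val x) (submod_rpredZ a (valP x)).
Definition sq_eqv : rel carrier := fun x y => val x - val y \in B.

End Subquotient.

Section SubquotientModule.
Variables (R : pzRingType) (M : lmodType R) (Z B : submodClosed M).
Local Notation carrier := {x : M | x \in Z}.
Local Notation eqv := (sq_eqv (Z := Z) B).

Lemma sq_eqv_val x y : val x = val y -> eqv x y.
Proof. by move=> e; rewrite /sq_eqv e subrr rpred0. Qed.

Lemma sq_equiv : equiv_class_of eqv.
Proof.
split=> [x | x y | y x z]; first exact: sq_eqv_val.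
  by apply/idP/idP => /submod_rpredN; rewrite opprB.
by move=> h1 h2; rewrite /sq_eqv -(subrKA (val y)) rpredD.
Qed.

Definition sq_premodule : premodule R.
Proof.
apply: (@Premodule R carrier (sq_zero Z) (@sq_opp _ _ Z) (@sq_add _ _ Z)
  (@sq_scale _ _ Z) eqv sq_equiv).
- by move=> x y h; rewrite /sq_eqv /= -opprD submod_rpredN.
- by move=> x x' y y' h h'; rewrite /sq_eqv /= opprD addrACA rpredD.
- by move=> a x y h; rewrite /sq_eqv /= -scalerBr rpredZ.
- by move=> x y z; apply: sq_eqv_val; rewrite /= addrA.
- by move=> x y; apply: sq_eqv_val; rewrite /= addrC.
- by move=> x; apply: sq_eqv_val; rewrite /= add0r.
- by move=> x; apply: sq_eqv_val; rewrite /= addNr.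
- by move=> a b x; apply: sq_eqv_val; rewrite /= scalerA.
- by move=> x; apply: sq_eqv_val; rewrite /= scale1r.
- by move=> a x y; apply: sq_eqv_val; rewrite /= scalerDr.
- by move=> x a b; apply: sq_eqv_val; rewrite /= scalerDl.
Defined.

Definition subquot : lmodType R := qmod sq_premodule.

Definition sqcls (x : M) (xZ : x \in Z) : subquot :=
  @qcls R sq_premodule (exist _ x xZ).

Lemma sqcls_eq x y (xZ : x \in Z) (yZ : y \in Z) :
  sqcls xZ = sqcls yZ <-> x - y \in B.
Proof. by split=> [/(qclsP (T := sq_premodule)) | h]; last exact/qclsP. Qed.

End SubquotientModule.

Section SubquotientMap.
Variables (R : pzRingType) (M M' : lmodType R).
Variables (Z B : submodClosed M) (Z' B' : submodClosed M').
Variables (h : {linear M -> M'}) (hZ : forall x, x \in Z -> h x \in Z').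

Definition subquot_map (c : subquot Z B) : subquot Z' B' :=
  sqcls B' (hZ (valP (repr c))).

Lemma subquot_mapE x (xZ : x \in Z) : (forall y, y \in B -> h y \in B') ->
  subquot_map (sqcls B xZ) = sqcls B' (hZ xZ).
Proof.
move=> hB; apply/sqcls_eq; rewrite -linearB; apply: hB.
exact: (@peqv_repr _ (sq_premodule Z B)).
Qed.

End SubquotientMap.

Arguments subquot_map {R M M' Z B Z' B' h} hZ c.

Section Localization.
Variables (R : comNzRingType) (S : mulrClosed R) (M : lmodType R).

Local Notation denominator := {s : R | s \in S}.
Local Notation fraction := (M * denominator)%type.

Definition den1 : denominator := exist _ 1 (rpred1 S).
Definition denM (s t : denominator) : denominator :=
  exist _ (sval s * sval t) (rpredM (valP s) (valP t)).

Definition loc_zero : fraction := (0, den1).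
Definition loc_opp (x : fraction) : fraction := (- x.1, x.2).
Definition loc_add (x y : fraction) : fraction :=
  (sval y.2 *: x.1 + sval x.2 *: y.1, denM x.2 y.2).
Definition loc_scale a (x : fraction) : fraction := (a *: x.1, x.2).
Definition loc_eqv : rel fraction := fun x y =>
  `[< exists2 u, u \in S & u *: (sval y.2 *: x.1) = u *: (sval x.2 *: y.1) >].

Lemma loc_eqv1 x y : sval y.2 *: x.1 = sval x.2 *: y.1 -> loc_eqv x y.
Proof. by move=> e; apply/asboolP; exists 1; rewrite ?rpred1 ?e. Qed.

Lemma loc_equiv : equiv_class_of loc_eqv.
Proof.
split=> [x | x y | y x z]; first exact: loc_eqv1.
  by apply/asboolP/asboolP => -[u uS e]; exists u.
move=> /asboolP[u uS e] /asboolP[v vS f].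
apply/asboolP; exists (u * v * sval y.2); first by rewrite !rpredM // (valP y.2).
have e' := congr1 (fun w => (v * sval z.2) *: w) e.
have f' := congr1 (fun w => (u * sval x.2) *: w) f.
move: e' f'; rewrite !scalerA => e' f'.
transitivity ((v * sval z.2 * u * sval y.2) *: x.1); first by congr (_ *: _); ring.
rewrite e'; transitivity ((u * sval x.2 * v * sval z.2) *: y.1).
  by congr (_ *: _); ring.
by rewrite f'; congr (_ *: _); ring.
Qed.

Definition loc_premodule : premodule R.
Proof.
apply: (@Premodule R fraction loc_zero loc_opp loc_add loc_scale loc_eqv
  loc_equiv).
- move=> x y /asboolP[u uS e]; apply/asboolP; exists u => //=.
  by rewrite !scalerN e.
- move=> x x' y y' /asboolP[u uS e] /asboolP[v vS f].
  apply/asboolP; exists (u * v); first by rewrite rpredM.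
  have e' := congr1 (fun w => (v * sval y.2 * sval y'.2) *: w) e.
  have f' := congr1 (fun w => (u * sval x.2 * sval x'.2) *: w) f.
  move: e' f'; rewrite /= !scalerDr !scalerA => e' f'; congr (_ + _).
    transitivity ((v * sval y.2 * sval y'.2 * u * sval x'.2) *: x.1).
      by congr (_ *: _); ring.
    by rewrite e'; congr (_ *: _); ring.
  transitivity ((u * sval x.2 * sval x'.2 * v * sval y'.2) *: y.1).
    by congr (_ *: _); ring.
  by rewrite f'; congr (_ *: _); ring.
- move=> a x y /asboolP[u uS e]; apply/asboolP; exists u => //=.
  have := congr1 (fun w => a *: w) e; rewrite !scalerA => e'.
  transitivity ((a * (u * sval y.2)) *: x.1); first by congr (_ *: _); ring.
  by rewrite e'; congr (_ *: _); ring.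
- move=> x y z; apply: loc_eqv1; rewrite /= !scalerDr !scalerA addrA.
  by congr (_ + _ + _); congr (_ *: _); ring.
- move=> x y; apply: loc_eqv1; rewrite /= !scalerDr !scalerA addrC.
  by congr (_ + _); congr (_ *: _); ring.
- move=> x; apply: loc_eqv1; rewrite /= scaler0 add0r !scalerA.
  by congr (_ *: _); ring.
- move=> x; apply: loc_eqv1.
  by rewrite /= scalerN addNr !scaler0.
- by move=> a b x; apply: loc_eqv1; rewrite /= !scalerA mulrA.
- by move=> x; apply: loc_eqv1; rewrite /= scale1r.
- move=> a x y; apply: loc_eqv1; rewrite /= !scalerDr !scalerA.
  by congr (_ + _); congr (_ *: _); ring.
- move=> x a b; apply: loc_eqv1; rewrite /= !scalerDr !scalerA -scalerDl.
  by congr (_ *: _); ring.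
Defined.

(* The module of fractions S^-1 M over R. *)
Definition locm : lmodType R := qmod loc_premodule.

Definition num (x : locm) : M := (repr x : fraction).1.
Definition den (x : locm) : R := sval (repr x : fraction).2.

(* The fraction m / s; the value is irrelevant when s is not in S. *)
Definition frac (m : M) (s : R) : locm :=
  @qcls R loc_premodule (m, insubd den1 s).

Lemma den_in x : den x \in S. Proof. exact: valP. Qed.

Lemma frac_eq m s m' s' : s \in S -> s' \in S ->
  frac m s = frac m' s' <-> exists2 u, u \in S & u *: (s' *: m) = u *: (s *: m').
Proof.
move=> sS s'S; have e t : t \in S -> sval (insubd den1 t) = t by exact: insubdK.
split=> [/(qclsP (T := loc_premodule))/asboolP | h].
  by move=> -[u uS]; rewrite /= !e // => h; exists u.
by apply/(qclsP (T := loc_premodule))/asboolP; rewrite /= !e.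
Qed.

Lemma frac_num_den x : frac (num x) (den x) = x.
Proof.
rewrite -[RHS]qcls_repr /frac /den /num.
by case: (repr x : fraction) => m s /=; rewrite (valKd den1 s).
Qed.

Lemma fracD m s m' s' : s \in S -> s' \in S ->
  frac m s + frac m' s' = frac (s' *: m + s *: m') (s * s').
Proof.
move=> sS s'S; rewrite /frac -(qclsD (T := loc_premodule)) /= /loc_add /=.
have e t : t \in S -> sval (insubd den1 t) = t by exact: insubdK.
rewrite !e //; congr (@qcls R loc_premodule (_, _)); apply: val_inj.
by rewrite /= !e ?rpredM.
Qed.

Lemma fracZ a m s : a *: frac m s = frac (a *: m) s.
Proof. by rewrite /frac -(qclsZ (T := loc_premodule)). Qed.

End Localization.

Arguments frac {R} S {M} m s.

(* The canonical map from S^-1 M to T^-1 M, when every element of S divides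
   an element of T: it sends m / s to (c *: m) / (c * s), where c * s is in T. *)
Section LocalizationMap.
Variables (R : comNzRingType) (S T : mulrClosed R) (M : lmodType R).

Definition cofactor_in (s : R) : R :=
  if pselect (exists c, c * s \in T) is left h then xchoose h else 1.

Definition loc_map (x : locm S M) : locm T M :=
  frac T (cofactor_in (den x) *: num x) (cofactor_in (den x) * den x).

Hypothesis ST : forall s, s \in S -> exists c, c * s \in T.

Lemma cofactor_inP s : s \in S -> cofactor_in s * s \in T.
Proof.
by move=> /ST h; rewrite /cofactor_in; case: pselect => // h'; apply: (xchooseP h').
Qed.

Lemma loc_mapE m s c : s \in S -> c * s \in T ->
  loc_map (frac S m s) = frac T (c *: m) (c * s).
Proof.
move=> sS csT; set x := frac S m s; rewrite /loc_map.
have := esym (frac_num_den x); rewrite /x; have dS := den_in x.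
move/(frac_eq _ _ sS dS) => [u uS e]; have [d duT] := ST uS.
apply/frac_eq => //; first exact: cofactor_inP.
exists (d * u) => //; move: (cofactor_in _) => k.
have := congr1 (fun w => (c * d * k) *: w) e; rewrite !scalerA -/x => e'.
transitivity ((c * d * k * u * s) *: num x); first by congr (_ *: _); ring.
by rewrite -e'; congr (_ *: _); ring.
Qed.

Lemma loc_map_linear : linear loc_map.
Proof.
move=> a x y; rewrite -(frac_num_den x) -(frac_num_den y).
have xS := den_in x; have yS := den_in y.
have xT := cofactor_inP xS; have yT := cofactor_inP yS.
rewrite fracZ fracD // !(loc_mapE _ _ xT, loc_mapE _ _ yT) //.
have xyT : cofactor_in (den x) * cofactor_in (den y) * (den x * den y) \in T.
  rewrite mulrACA; exact: rpredM.
rewrite (loc_mapE _ _ xyT) ?rpredM // fracZ fracD //.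
apply/frac_eq; [exact: xyT | exact: rpredM | exists 1; first exact: rpred1].
rewrite !scale1r !scalerDr !scalerA; congr (_ + _); congr (_ *: _); ring.
Qed.

End LocalizationMap.

Section LocalRing.
Variables (R : comNzRingType) (P : prime_idealr R).

Definition prime_compl : {pred R} := [predC P].

Lemma prime_compl_mulr_closed : mulr_closed prime_compl.
Proof.
split=> [|x y]; first by rewrite inE idealr1.
by rewrite !inE prime_idealrM negb_or => -> ->.
Qed.
HB.instance Definition _ :=
  GRing.isMulClosed.Build R prime_compl prime_compl_mulr_closed.

(* The local ring R_P. *)
Definition loc_ring := locm prime_compl R^o.
HB.instance Definition _ := GRing.Lmodule.on loc_ring.

Definition lr_one : loc_ring := frac prime_compl (1 : R^o) 1.
Definition lr_mul (x y : loc_ring) : loc_ring :=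
  frac prime_compl (num x * num y : R^o) (den x * den y).

Lemma lr_mulE (m m' : R^o) s s' : s \in prime_compl -> s' \in prime_compl ->
  lr_mul (frac _ m s) (frac _ m' s') = frac _ (m * m') (s * s').
Proof.
move=> sS sS'; set x := frac _ m s; set y := frac _ m' s'.
have [u uS e] := (frac_eq _ _ (den_in x) sS).1 (frac_num_den x).
have [v vS f] := (frac_eq _ _ (den_in y) sS').1 (frac_num_den y).
apply/frac_eq; rewrite ?rpredM ?den_in //; exists (u * v); rewrite ?rpredM //.
rewrite /GRing.scale /= in e f *.
transitivity ((u * (s * num x)) * (v * (s' * num y))); first by ring.
by rewrite e f; ring.
Qed.

Local Notation S := prime_compl.

Lemma frac_ind (Q : loc_ring -> Prop) :
  (forall (m : R^o) s, s \in S -> Q (frac S m s)) -> forall x, Q x.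
Proof. by move=> h x; rewrite -(frac_num_den x); apply/h/den_in. Qed.

Lemma lr_mulA : associative lr_mul.
Proof.
elim/frac_ind=> m s sS; elim/frac_ind=> m' s' s'S; elim/frac_ind=> m'' s'' s''S.
by rewrite !lr_mulE ?rpredM // !mulrA.
Qed.

Lemma lr_mulC : commutative lr_mul.
Proof.
elim/frac_ind=> m s sS; elim/frac_ind=> m' s' s'S.
by rewrite !lr_mulE // mulrC [s * _]mulrC.
Qed.

Lemma lr_mul1 : left_id lr_one lr_mul.
Proof. by elim/frac_ind=> m s sS; rewrite lr_mulE ?rpred1 // !mul1r. Qed.

Lemma lr_mulDl : left_distributive lr_mul +%R.
Proof.
elim/frac_ind=> m s sS; elim/frac_ind=> m' s' s'S; elim/frac_ind=> m'' s'' s''S.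
rewrite !lr_mulE // !fracD ?rpredM // lr_mulE ?rpredM //.
apply/frac_eq; rewrite ?rpredM //; exists 1; first exact: rpred1.
by rewrite /GRing.scale /=; ring.
Qed.

Lemma lr_one_neq0 : lr_one != 0.
Proof.
have -> : 0 = frac S (0 : R^o) 1 by rewrite -[0 : R^o](scale0r (0 : R^o)) -fracZ scale0r.
apply/eqP => /(frac_eq _ _ (rpred1 _) (rpred1 _)) [u uS].
by rewrite !scale1r scaler0 /GRing.scale /= mulr1 => u0;
  move: uS; rewrite u0 !inE rpred0.
Qed.

HB.instance Definition _ := GRing.Zmodule_isComNzRing.Build loc_ring
  lr_mulA lr_mulC lr_mul1 lr_mulDl lr_one_neq0.

End LocalRing.

(* Elements of tensor M N are formal sums of pairs, written as sequences.  Two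
   formal sums are equal in tensor M N when every bilinear map out of M x N
   takes the same value on them, that is, tensor M N is the quotient that has
   the universal property (tensor_lift below). *)
Section Tensor.
Variables (R : comNzRingType) (M N : lmodType R).

Definition bilin (L : lmodType R) (b : M -> N -> L) : Prop :=
  (forall x, linear (b x)) /\ (forall y, linear (b^~ y)).

Definition bsum (L : lmodType R) (b : M -> N -> L) (s : seq (M * N)) : L :=
  \sum_(p <- s) b p.1 p.2.

Definition tensor_eqv : rel (seq (M * N)) := fun s t =>
  `[< forall (L : lmodType R) (b : M -> N -> L), bilin b -> bsum b s = bsum b t >].

Definition tscale a (s : seq (M * N)) := [seq (a *: p.1, p.2) | p <- s].

Lemma bilinDl (L : lmodType R) (b : M -> N -> L) x x' y :
  bilin b -> b (x + x') y = b x y + b x' y.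
Proof. by move=> [_ h]; have := h y 1 x x'; rewrite !scale1r. Qed.

Lemma bilinDr (L : lmodType R) (b : M -> N -> L) x y y' :
  bilin b -> b x (y + y') = b x y + b x y'.
Proof. by move=> [h _]; have := h x 1 y y'; rewrite !scale1r. Qed.

Lemma bilin0l (L : lmodType R) (b : M -> N -> L) y : bilin b -> b 0 y = 0.
Proof. by move=> h; apply: (addrI (b 0 y)); rewrite -bilinDl // !addr0. Qed.

Lemma bilin0r (L : lmodType R) (b : M -> N -> L) x : bilin b -> b x 0 = 0.
Proof. by move=> h; apply: (addrI (b x 0)); rewrite -bilinDr // !addr0. Qed.

Lemma bilinZl (L : lmodType R) (b : M -> N -> L) a x y : bilin b -> b (a *: x) y = a *: b x y.
Proof.
by move=> h; have := h.2 y a x 0; rewrite !addr0 bilin0l // addr0.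
Qed.

Lemma bilinZr (L : lmodType R) (b : M -> N -> L) a x y : bilin b -> b x (a *: y) = a *: b x y.
Proof.
by move=> h; have := h.1 x a y 0; rewrite !addr0 bilin0r // addr0.
Qed.

Lemma bsum_cat (L : lmodType R) (b : M -> N -> L) s t : bsum b (s ++ t) = bsum b s + bsum b t.
Proof. exact: big_cat. Qed.

Lemma bsum_scale (L : lmodType R) (b : M -> N -> L) a s :
  bilin b -> bsum b (tscale a s) = a *: bsum b s.
Proof.
move=> h; rewrite /bsum big_map scaler_sumr; apply: eq_bigr => p _.
exact: bilinZl.
Qed.

Lemma tensor_equiv : equiv_class_of tensor_eqv.
Proof.
split=> [s | s t | s t u]; first by apply/asboolP.
  by apply/asboolP/asboolP => h L b hb; rewrite h.
by move=> /asboolP h /asboolP k; apply/asboolP => L b hb; rewrite h ?k.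
Qed.

Definition tensor_premodule : premodule R.
Proof.
apply: (@Premodule R (seq (M * N)) [::] (tscale (-1)) cat tscale tensor_eqv
  tensor_equiv).
- by move=> s t /asboolP h; apply/asboolP => L b hb; rewrite !bsum_scale // h.
- move=> s s' t t' /asboolP h /asboolP k; apply/asboolP => L b hb.
  by rewrite !bsum_cat h // k.
- by move=> a s t /asboolP h; apply/asboolP => L b hb; rewrite !bsum_scale // h.
- by move=> s t u; rewrite catA; apply/asboolP.
- by move=> s t; apply/asboolP => L b hb; rewrite !bsum_cat addrC.
- by move=> s; apply/asboolP.
- move=> s; apply/asboolP => L b hb.
  by rewrite bsum_cat bsum_scale // scaleN1r addNr /bsum big_nil.
- by move=> a c s; apply/asboolP => L b hb; rewrite !bsum_scale // scalerA.
- by move=> s; apply/asboolP => L b hb; rewrite bsum_scale // scale1r.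
- move=> a s t; apply/asboolP => L b hb.
  by rewrite bsum_cat !bsum_scale // bsum_cat scalerDr.
- move=> s a c; apply/asboolP => L b hb.
  by rewrite bsum_cat !bsum_scale // scalerDl.
Defined.

Definition tensor : lmodType R := qmod tensor_premodule.

Definition tsum (s : seq (M * N)) : tensor := @qcls R tensor_premodule s.

Definition pure_tensor (x : M) (y : N) : tensor := tsum [:: (x, y)].

Lemma tsum_eq s t : tsum s = tsum t <->
  forall (L : lmodType R) (b : M -> N -> L), bilin b -> bsum b s = bsum b t.
Proof.
split; first by move/(qclsP (T := tensor_premodule))/asboolP.
by move=> h; apply/(qclsP (T := tensor_premodule))/asboolP.
Qed.

Lemma tsumE s : tsum s = \sum_(p <- s) pure_tensor p.1 p.2.
Proof.
elim: s => [|p s IH]; first by rewrite big_nil.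
rewrite big_cons -IH -(qclsD (T := tensor_premodule)) /=.
by case: p.
Qed.

Lemma pure_tensor_bilin : bilin pure_tensor.
Proof.
split=> [x a y y' | y a x x']; rewrite -(qclsZ (T := tensor_premodule));
  rewrite -(qclsD (T := tensor_premodule)); apply/tsum_eq => L b hb;
  rewrite /bsum /= !big_cons !big_nil /= !addr0.
  by rewrite bilinDr // bilinZr // bilinZl.
by rewrite bilinDl // bilinZl.
Qed.

Lemma tensor_lift (L : lmodType R) (b : M -> N -> L) : bilin b ->
  exists2 f : {linear tensor -> L}, forall x y, f (pure_tensor x y) = b x y &
  forall g : {linear tensor -> L},
    (forall x y, g (pure_tensor x y) = b x y) -> g =1 f.
Proof.
move=> hb; pose f0 (t : tensor) : L := bsum b (repr t).
have f0E s : f0 (tsum s) = bsum b s.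
  have := peqv_repr (T := tensor_premodule) s.
  by move/asboolP => h; rewrite /f0 h.
have f0L : linear f0.
  move=> a t u; rewrite -(qcls_repr t) -(qcls_repr u).
  rewrite -(qclsZ (T := tensor_premodule)) -(qclsD (T := tensor_premodule)).
  by rewrite !f0E /= bsum_cat bsum_scale.
pose f : {linear tensor -> L} :=
  HB.pack f0 (GRing.isLinear.Build R tensor L *:%R f0 f0L).
exists f => [x y | g gE t]; first by rewrite /= f0E /bsum big_seq1.
rewrite -(qcls_repr t) [RHS]f0E -[qcls _]/(tsum _) tsumE linear_sum.
by apply: eq_bigr => p _; apply: gE.
Qed.

End Tensor.

Section TensorMap.
Variables (R : comNzRingType) (F N N' : lmodType R) (f : {linear N -> N'}).

(* The map F (x) f : F (x) N -> F (x) N'. *)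
Definition tensor_map (t : tensor F N) : tensor F N' :=
  tsum [seq (p.1, f p.2) | p : F * N <- repr t].

Lemma tensor_map_sum s :
  tensor_map (tsum s) = tsum [seq (p.1, f p.2) | p : F * N <- s].
Proof.
apply/tsum_eq => L b hb; rewrite /bsum !big_map.
have := peqv_repr (T := tensor_premodule F N) s.
move/asboolP/(_ L (fun x y => b x (f y))); apply; split=> [x|y] a u v.
  by rewrite linearP hb.1.
exact: hb.2.
Qed.

End TensorMap.

Arguments tensor_map {R} F {N N'} f t.

Definition exact_pair (U V W : nmodType) (f : U -> V) (g : V -> W) : Prop :=
  forall y, g y = 0 <-> exists x, f x = y.

Definition flat (R : comNzRingType) (F : lmodType R) : Prop :=
  forall (N' N N'' : lmodType R) (f : {linear N' -> N}) (g : {linear N -> N''}),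
    exact_pair f g -> exact_pair (tensor_map F f) (tensor_map F g).

(* M has a flat resolution 0 -> F_n -> ... -> F_0 -> M -> 0. *)
Definition flat_dim_le (R : comNzRingType) (M : lmodType R) (n : nat) : Prop :=
  exists (F : nat -> lmodType R) (d : forall i, {linear F i.+1 -> F i})
         (e : {linear F 0%N -> M}),
    [/\ forall i, flat (F i),
        forall i, (n < i)%N -> forall x : F i, x = 0,
        forall y, exists x, e x = y,
        exact_pair (d 0%N) e
      & forall i, exact_pair (d i.+1) (d i)].

(* The supremum of the flat dimensions of all R-modules is finite. *)
Definition finite_weak_dim (R : comNzRingType) : Prop :=
  exists n, forall M : lmodType R, flat_dim_le M n.

Section FiniteGeneration.
Variables (R : comNzRingType) (M : lmodType R).

Definition span n (v : 'I_n -> M) : {pred M} :=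
  fun x => `[< exists c : 'I_n -> R, x = \sum_i c i *: v i >].

Lemma span_submod n (v : 'I_n -> M) : submod_closed (span v).
Proof.
split; first by apply/asboolP; exists (fun=> 0); rewrite big1 // => i; rewrite scale0r.
move=> a _ _ /asboolP[c ->] /asboolP[d ->]; apply/asboolP.
exists (fun i => a * c i + d i); rewrite scaler_sumr -big_split /=.
by apply: eq_bigr => i _; rewrite scalerDl scalerA.
Qed.
HB.instance Definition _ n (v : 'I_n -> M) :=
  GRing.isSubmodClosed.Build R M (span v) (span_submod v).

Definition finitely_generated (N : {pred M}) : Prop :=
  exists n (v : 'I_n -> M), N =i span v.

End FiniteGeneration.

(* The submodule N is the image of some R^n under a linear map that has a
   finitely generated kernel. *)
Definition finitely_presented (R : comNzRingType) (M : lmodType R)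
    (N : {pred M}) : Prop :=
  exists n (f : {linear 'rV[R]_n -> M}),
    (forall x, x \in N <-> exists u, f u = x) /\
    finitely_generated [pred u | f u == 0].

Definition coherent (R : comNzRingType) : Prop :=
  forall I : {pred R^o}, finitely_generated I -> finitely_presented I.

Definition stably_coherent (A : comNzRingType) : Prop :=
  coherent A /\ forall n, (0 < n)%N -> coherent {mpoly A[n]}.

(* The number of elements of I below j; (-1) ^+ before j I is the sign of the
   component of the Koszul and Cech differentials indexed by I and j. *)
Definition before r (j : 'I_r) (I : {set 'I_r}) : nat :=
  #|[set k in I | (k < j)%N]|.

(* The Koszul complex of a_0, ..., a_(r-1) on R: the exterior algebra of R^r,
   where x I is the coordinate of x on the basis vector e_I, the wedge product
   of the e_j for j in I.  Its part of degree i is spanned by the e_I with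
   #|I| = i, and d e_I = \sum_(j in I) (-1) ^+ before j I * a_j e_(I :\ j). *)
Notation koszul_complex R r := {ffun {set 'I_r} -> R^o}.

Section Koszul.
Variables (R : comNzRingType) (r : nat) (a : 'I_r -> R).

Local Notation koszul := (koszul_complex R r).

Definition koszul_diff (x : koszul) : koszul :=
  [ffun J : {set 'I_r} => \sum_(j | j \notin J) (-1) ^+ before j J * a j * x (j |: J)].

Definition koszul_homogeneous (i : nat) (x : koszul) : Prop :=
  forall I : {set 'I_r}, #|I| != i -> x I = 0.

Definition koszul_cycle i : {pred koszul} :=
  fun x => `[< koszul_homogeneous i x /\ koszul_diff x = 0 >].

Definition koszul_boundary i : {pred koszul} :=
  fun x => `[< exists2 y, koszul_homogeneous i.+1 y & x = koszul_diff y >].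

Lemma koszul_diff_linear : linear koszul_diff.
Proof.
move=> c x y; apply/ffunP => J; rewrite !ffunE scaler_sumr -big_split /=.
by apply: eq_bigr => j _; rewrite !ffunE /GRing.scale /=; ring.
Qed.

Lemma koszul_homogeneousP i c x y : koszul_homogeneous i x ->
  koszul_homogeneous i y -> koszul_homogeneous i (c *: x + y).
Proof. by move=> hx hy I hI; rewrite !ffunE hx // hy // scaler0 addr0. Qed.

Lemma koszul_homogeneous0 i : koszul_homogeneous i 0.
Proof. by move=> I _; rewrite ffunE. Qed.

Lemma koszul_diff0 : koszul_diff 0 = 0.
Proof.
have := koszul_diff_linear (-1) 0 0.
by rewrite scaleN1r oppr0 addr0 scaleN1r addNr.
Qed.

Lemma koszul_cycle_submod i : submod_closed (koszul_cycle i).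
Proof.
split; first by apply/asboolP; split; [exact: koszul_homogeneous0 | exact: koszul_diff0].
move=> c x y /asboolP[hx dx] /asboolP[hy dy]; apply/asboolP.
split; first exact: koszul_homogeneousP.
by rewrite koszul_diff_linear dx dy scaler0 addr0.
Qed.
HB.instance Definition _ i :=
  GRing.isSubmodClosed.Build R koszul (koszul_cycle i) (koszul_cycle_submod i).

Lemma koszul_boundary_submod i : submod_closed (koszul_boundary i).
Proof.
split.
  by apply/asboolP; exists 0; [exact: koszul_homogeneous0 | rewrite koszul_diff0].
move=> c _ _ /asboolP[x hx ->] /asboolP[y hy ->]; apply/asboolP.
by exists (c *: x + y); [exact: koszul_homogeneousP | rewrite koszul_diff_linear].
Qed.
HB.instance Definition _ i :=
  GRing.isSubmodClosed.Build R koszul (koszul_boundary i)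
    (koszul_boundary_submod i).

Definition koszul_homology i : lmodType R :=
  subquot (koszul_cycle i) (koszul_boundary i).

End Koszul.

Section KoszulPowers.
Variables (R : comNzRingType) (r : nat) (a : 'I_r -> R).

Definition pow_seq (n : nat) : 'I_r -> R := fun j => a j ^+ n.

(* The tensor product over j of the maps K(a_j ^+ m) -> K(a_j ^+ n) that are
   the identity in degree 0 and multiplication by a_j ^+ (m - n) in degree 1. *)
Definition koszul_phi (m n : nat) (x : koszul_complex R r) : koszul_complex R r :=
  [ffun I : {set 'I_r} => (\prod_(j in I) a j ^+ (m - n)) * x I].

Lemma koszul_phi_linear m n : linear (koszul_phi m n).
Proof.
by move=> c x y; apply/ffunP => I; rewrite !ffunE /GRing.scale /=; ring.
Qed.
HB.instance Definition _ m n := GRing.isLinear.Build R (koszul_complex R r)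
  (koszul_complex R r) *:%R (koszul_phi m n) (koszul_phi_linear m n).

Lemma koszul_phi_homogeneous m n i x :
  koszul_homogeneous i x -> koszul_homogeneous i (koszul_phi m n x).
Proof. by move=> hx I hI; rewrite ffunE hx // mulr0. Qed.

Lemma koszul_phi_diff m n x : (n <= m)%N ->
  koszul_diff (pow_seq n) (koszul_phi m n x) =
  koszul_phi m n (koszul_diff (pow_seq m) x).
Proof.
move=> le_nm; apply/ffunP => J; rewrite !ffunE mulr_sumr.
apply: eq_bigr => j jJ; rewrite ffunE big_setU1 //= /pow_seq.
rewrite -{4}(subnK le_nm) exprD; ring.
Qed.

Lemma koszul_phi_cycle m n i : (n <= m)%N -> forall x,
  x \in koszul_cycle (pow_seq m) i -> koszul_phi m n x \in koszul_cycle (pow_seq n) i.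
Proof.
move=> le_nm x /asboolP[hx dx]; apply/asboolP.
split; first exact: koszul_phi_homogeneous.
by rewrite koszul_phi_diff // dx linear0.
Qed.

Lemma koszul_phi_boundary m n i : (n <= m)%N -> forall x,
  x \in koszul_boundary (pow_seq m) i ->
  koszul_phi m n x \in koszul_boundary (pow_seq n) i.
Proof.
move=> le_nm _ /asboolP[y hy ->]; apply/asboolP; exists (koszul_phi m n y).
  exact: koszul_phi_homogeneous.
by rewrite koszul_phi_diff.
Qed.

Definition koszul_homology_map m n i (le_nm : (n <= m)%N) :
    koszul_homology (pow_seq m) i -> koszul_homology (pow_seq n) i :=
  subquot_map (h := koszul_phi m n) (koszul_phi_cycle le_nm).

Definition weakly_proregular : Prop :=
  forall i, (1 <= i <= r)%N -> forall n, exists m (le_nm : (n <= m)%N),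
    forall c, koszul_homology_map (i := i) le_nm c = 0.

End KoszulPowers.

(* Product of a family of modules. *)
Section ModuleProduct.
Variables (R : pzRingType) (I : Type) (V : I -> lmodType R).

Definition mod_prod : Type := forall i, V i.
HB.instance Definition _ := gen_eqMixin mod_prod.
HB.instance Definition _ := gen_choiceMixin mod_prod.

Definition mp_zero : mod_prod := fun i => 0.
Definition mp_opp (x : mod_prod) : mod_prod := fun i => - x i.
Definition mp_add (x y : mod_prod) : mod_prod := fun i => x i + y i.
Definition mp_scale a (x : mod_prod) : mod_prod := fun i => a *: x i.

Lemma mp_addA : associative mp_add.
Proof. by move=> x y z; apply: functional_extensionality_dep => i; apply: addrA. Qed.
Lemma mp_addC : commutative mp_add.
Proof. by move=> x y; apply: functional_extensionality_dep => i; apply: addrC. Qed.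
Lemma mp_add0 : left_id mp_zero mp_add.
Proof. by move=> x; apply: functional_extensionality_dep => i; apply: add0r. Qed.
Lemma mp_addN : left_inverse mp_zero mp_opp mp_add.
Proof. by move=> x; apply: functional_extensionality_dep => i; apply: addNr. Qed.
HB.instance Definition _ :=
  GRing.isZmodule.Build mod_prod mp_addA mp_addC mp_add0 mp_addN.

Lemma mp_scaleA a b x : mp_scale a (mp_scale b x) = mp_scale (a * b) x.
Proof. by apply: functional_extensionality_dep => i; apply: scalerA. Qed.
Lemma mp_scale1 : left_id 1 mp_scale.
Proof. by move=> x; apply: functional_extensionality_dep => i; apply: scale1r. Qed.
Lemma mp_scaleDr : right_distributive mp_scale +%R.
Proof. by move=> a x y; apply: functional_extensionality_dep => i; apply: scalerDr. Qed.
Lemma mp_scaleDl x : {morph mp_scale^~ x : a b / a + b >-> a + b}.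
Proof. by move=> a b; apply: functional_extensionality_dep => i; apply: scalerDl. Qed.
HB.instance Definition _ := GRing.Zmodule_isLmodule.Build R mod_prod
  mp_scaleA mp_scale1 mp_scaleDr mp_scaleDl.

Lemma mod_prodD (x y : mod_prod) i : (x + y) i = x i + y i. Proof. by []. Qed.
Lemma mod_prodZ a (x : mod_prod) i : (a *: x) i = a *: x i. Proof. by []. Qed.
Lemma mod_prodP (x y : mod_prod) : (forall i, x i = y i) -> x = y.
Proof. exact: functional_extensionality_dep. Qed.

End ModuleProduct.

Section Powers.
Variables (R : comNzRingType) (f : R).

(* The powers of f, so that locm (powers f) M is M_f. *)
Definition powers : {pred R} := fun s => `[< exists n, s = f ^+ n >].

Lemma powers_mulr_closed : mulr_closed powers.
Proof.
split=> [|_ _ /asboolP[m ->] /asboolP[n ->]]; apply/asboolP; first by exists 0%N.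
by exists (m + n)%N; rewrite exprD.
Qed.
HB.instance Definition _ := GRing.isMulClosed.Build R powers powers_mulr_closed.

End Powers.

(* The Cech complex of a_0, ..., a_(r-1) on R: its part of degree k is the
   product over the I with #|I| = k of the localizations of R at the product of
   the a_j for j in I. *)
Section Cech.
Variables (R : comNzRingType) (r : nat) (a : 'I_r -> R).

Definition cech_den (I : {set 'I_r}) : mulrClosed R := powers (\prod_(j in I) a j).

Definition cech : lmodType R :=
  mod_prod (fun I : {set 'I_r} => locm (cech_den I) R^o).

Definition cech_diff (x : cech) : cech := fun J =>
  \sum_(j in J) (-1) ^+ before j J *: loc_map (cech_den J) (x (J :\ j)).

Definition cech_homogeneous (k : nat) (x : cech) : Prop :=
  forall I : {set 'I_r}, #|I| != k -> x I = 0.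

Definition cech_cocycle k : {pred cech} :=
  fun x => `[< cech_homogeneous k x /\ cech_diff x = 0 >].

(* For k = 0 only y = 0 is allowed. *)
Definition cech_coboundary k : {pred cech} :=
  fun x => `[< exists2 y : cech, (forall I : {set 'I_r}, #|I|.+1 != k -> y I = 0)
                        & x = cech_diff y >].

Lemma cech_den_dvd (J : {set 'I_r}) j s : j \in J -> s \in cech_den (J :\ j) ->
  exists c, c * s \in cech_den J.
Proof.
move=> jJ /asboolP[n ->]; exists (a j ^+ n); apply/asboolP; exists n.
by rewrite -exprMn [in RHS](big_setD1 j).
Qed.

Lemma cech_diff_linear : linear cech_diff.
Proof.
move=> c x y; apply: mod_prodP => J; rewrite mod_prodD mod_prodZ.
rewrite /cech_diff.
pose t (z : cech) j := (-1) ^+ before j J *: loc_map (cech_den J) (z (J :\ j)).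
rewrite (eq_bigr (fun j => c *: t x j + t y j)) => [|j jJ].
  by rewrite big_split /= -scaler_sumr.
have ST s := @cech_den_dvd J j s jJ.
have L := loc_map_linear (M := R^o) ST c (x (J :\ j)) (y (J :\ j)).
by rewrite /t mod_prodD mod_prodZ [X in _ *: X]L scalerDr !scalerA mulrC.
Qed.

Lemma cech_diff0 : cech_diff 0 = 0.
Proof.
have := cech_diff_linear (-1) 0 0.
by rewrite scaleN1r oppr0 addr0 scaleN1r addNr.
Qed.

Lemma cech_cocycle_submod k : submod_closed (cech_cocycle k).
Proof.
split; first by apply/asboolP; split; [by [] | exact: cech_diff0].
move=> c x y /asboolP[hx dx] /asboolP[hy dy]; apply/asboolP; split.
  move=> I hI; by rewrite mod_prodD mod_prodZ hx // hy // scaler0 addr0.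
by rewrite cech_diff_linear dx dy scaler0 addr0.
Qed.
HB.instance Definition _ k :=
  GRing.isSubmodClosed.Build R cech (cech_cocycle k) (cech_cocycle_submod k).

Lemma cech_coboundary_submod k : submod_closed (cech_coboundary k).
Proof.
split; first by apply/asboolP; exists (0 : cech); rewrite ?cech_diff0.
move=> c _ _ /asboolP[x hx ->] /asboolP[y hy ->]; apply/asboolP.
exists (c *: x + y); last by rewrite cech_diff_linear.
move=> I hI; by rewrite mod_prodD mod_prodZ hx // hy // scaler0 addr0.
Qed.
HB.instance Definition _ k :=
  GRing.isSubmodClosed.Build R cech (cech_coboundary k)
    (cech_coboundary_submod k).

Definition cech_cohomology k : lmodType R :=
  subquot (cech_cocycle k) (cech_coboundary k).

End Cech.

Section CohenMacaulay.
Variable R : comNzRingType.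

Definition ideal_gen r (a : 'I_r -> R) : submodClosed R^o := span (a : 'I_r -> R^o).

(* The last condition says that the localization of the r-th Cech cohomology at
   every prime ideal that contains a is non-zero. *)
Definition parameter_sequence r (a : 'I_r -> R) : Prop :=
  [/\ weakly_proregular a,
      exists x, x \notin ideal_gen a
    & forall P : prime_idealr R, (forall j, a j \in P) ->
        exists x : locm (prime_compl P) (cech_cohomology a r), x != 0].

Definition prefix_seq r (a : 'I_r -> R) i (le_ir : (i <= r)%N) : 'I_i -> R :=
  fun j => a (widen_ord le_ir j).

Definition strong_parameter_sequence r (a : 'I_r -> R) : Prop :=
  forall i (le_ir : (i <= r)%N), (1 <= i)%N ->
    parameter_sequence (prefix_seq a le_ir).

(* The quotient R / I as an R-module. *)
Definition whole : {pred R^o} := predT.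
Lemma whole_submod : submod_closed whole. Proof. by []. Qed.
HB.instance Definition _ :=
  GRing.isSubmodClosed.Build R R^o whole whole_submod.
Definition quotient_mod (I : submodClosed R^o) : lmodType R := subquot whole I.

Definition regular_sequence r (a : 'I_r -> R) : Prop :=
  (forall (i : 'I_r)
     (x : quotient_mod (ideal_gen (prefix_seq a (ltnW (ltn_ord i))))),
     a i *: x = 0 -> x = 0) /\
  exists x : quotient_mod (ideal_gen a), x != 0.

Definition HMCM : Prop :=
  forall r (a : 'I_r -> R), strong_parameter_sequence a -> regular_sequence a.

End CohenMacaulay.

Definition locally_HMCM (R : comNzRingType) : Prop :=
  forall P : prime_idealr R, HMCM (loc_ring P).

(* Main.v *)
(* By Hilbert's syzygy theorem A[X_1..X_n] and its localizations have finite weak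
   dimension, and they are coherent.  Let R be such a ring, x_1..x_r a strong
   parameter sequence with x_1..x_(r-1) regular, I = (x_1..x_(r-1)), and suppose
   that x_r is a zero divisor modulo I, say x_r z in I with z not in I.  Let P be a
   minimal prime of (I : z) and T = R_P.  Over the coherent local ring T every
   finitely presented module has a finite minimal free resolution, since its Tor
   with the residue field vanishes in high degrees.  By minimality of P, finitely
   many elements of the maximal ideal of T always kill a common nonzero element of
   T/I; as T/I has flat dimension at most r-1, the resolution of T/(x^m) has no term
   in degree r (the Auslander-Buchsbaum inequality).  Weak proregularity makes the
   comparison map K(x^m) -> K(x^n) homotopic, for m large, to a map that factors
   through this resolution.  In degree r this says that (x_1...x_r)^(m-n) lies in
   (x_1^m, ..., x_r^m)T, so the r-th Cech cohomology vanishes at P, contradicting the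
   definition of a parameter sequence. *)

Require Import Defs.
From HB Require Import structures.
From mathcomp Require Import all_boot all_order all_algebra.
From mathcomp Require Import generic_quotient ring_quotient.
From mathcomp Require Import boolp classical_sets.
From mathcomp Require Import mpoly.
From mathcomp Require Import ring zify.

Set Implicit Arguments.
Unset Strict Implicit.
Unset Printing Implicit Defensive.
Import GRing.Theory.
Local Open Scope ring_scope.

(** Without Noetherian hypotheses an associated prime of R/I need not exist. At a minimal prime of
    (I : z) every nonunit of T still acts nilpotently on the class of z. This controls only finitely
    many nonunits at a time, which suffices because coherence makes every differential of a
    resolution a finite matrix. For the same reason flatness and Tor are expressed by matrices:
    [tor_vanish K n D] tests Tor against the cokernel of [D] alone, and the definition of flatness
    by tensor products enters only through [flat_eflat]. The resolution of T/(x^m) depends on m, and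
    each degree of its comparison with the Koszul complexes lowers the target level, since weak
    proregularity turns cycles into boundaries only after passing to a smaller exponent. The
    exponent n from which this descent to n' starts must therefore be fixed by n' and the number of
    degrees alone, before m and the resolution are chosen. *)

Lemma exists_fun X Y (P : X -> Y -> Prop) :
  (forall x, exists y, P x y) -> exists f, forall x, P x (f x).
Proof. by move=> /choice[f hf]; exists f. Qed.

(** * Flatness and Tor by matrices *)

Section Tuples.
Variables (R : comNzRingType).

Definition vmul (K : lmodType R) p q (y : {ffun 'I_p -> K}) (D : 'M[R]_(p, q)) :
    {ffun 'I_q -> K} := [ffun j => \sum_i D i j *: y i].

Definition vmap (K L : lmodType R) p (f : K -> L) (y : {ffun 'I_p -> K}) :
  {ffun 'I_p -> L} := [ffun i => f (y i)].

Lemma vmulA (K : lmodType R) p q s (y : {ffun 'I_p -> K}) (D : 'M_(p, q)) (E : 'M_(q, s)) :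
  vmul (vmul y D) E = vmul y (D *m E).
Proof.
apply/ffunP => j; rewrite !ffunE.
under eq_bigr do rewrite ffunE scaler_sumr.
rewrite exchange_big; apply: eq_bigr => i _; rewrite mxE scaler_suml.
by apply: eq_bigr => l _; rewrite scalerA mulrC.
Qed.

Lemma vmulBl (K : lmodType R) p q (y z : {ffun 'I_p -> K}) (D : 'M_(p, q)) :
  vmul (y - z) D = vmul y D - vmul z D.
Proof.
apply/ffunP => j; rewrite !ffunE -sumrB; apply: eq_bigr => i _.
by rewrite !ffunE scalerBr.
Qed.

Lemma vmul0 (K : lmodType R) p q (y : {ffun 'I_p -> K}) : vmul y (0 : 'M_(p, q)) = 0.
Proof.
by apply/ffunP => j; rewrite !ffunE big1 // => i _; rewrite mxE scale0r.
Qed.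

Lemma vmap_mul (K L : lmodType R) p q (f : {linear K -> L}) (y : {ffun 'I_p -> K})
  (D : 'M_(p, q)) : vmap f (vmul y D) = vmul (vmap f y) D.
Proof.
apply/ffunP => j; rewrite !ffunE linear_sum; apply: eq_bigr => i _.
by rewrite linearZ ffunE.
Qed.

Lemma vmapB (K L : lmodType R) p (f : {linear K -> L}) (y z : {ffun 'I_p -> K}) :
  vmap f (y - z) = vmap f y - vmap f z.
Proof. by apply/ffunP => j; rewrite !ffunE linearB. Qed.

Lemma vmap0 (K L : lmodType R) p (f : {linear K -> L}) :
  vmap f (0 : {ffun 'I_p -> K}) = 0.
Proof. by apply/ffunP => j; rewrite !ffunE linear0. Qed.

Lemma vmap_surj (K L : lmodType R) p (f : K -> L) (y : {ffun 'I_p -> L}) :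
  (forall i, exists x, f x = y i) -> exists x, vmap f x = y.
Proof.
move=> /exists_fun[g hg]; exists [ffun i => g i].
by apply/ffunP => i; rewrite !ffunE.
Qed.

(** Matrices act on row vectors, so [D] presents the cokernel of a map of free modules and [U] is
    the next differential of a free resolution. *)
Definition mexact p q s (U : 'M[R]_(p, q)) (D : 'M[R]_(q, s)) : Prop :=
  U *m D = 0 /\ forall u : 'rV_q, u *m D = 0 -> exists v, u = v *m U.

Lemma mexact_lift p q s k (U : 'M_(p, q)) (D : 'M_(q, s)) (V : 'M_(k, q)) :
  mexact U D -> V *m D = 0 -> exists W, V = W *m U.
Proof.
move=> [_ ex] VD.
have [f hf] : exists f : 'I_k -> 'rV_p, forall i, row i V = f i *m U.
  apply: (@exists_fun _ _ (fun i v => row i V = v *m U)) => i.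
  by apply: ex; rewrite -row_mul VD row0.
exists (\matrix_i f i); apply/row_matrixP => i.
by rewrite row_mul rowK hf.
Qed.

Definition mcoherent : Prop :=
  forall p q (D : 'M[R]_(p, q)), exists k (U : 'M_(k, p)), mexact U D.

(** Membership in the image of [K] tensored with the left kernel of [D]. The number [k] of relations
    is left free, since that kernel need not be finitely generated. *)
Definition relation_comb (K : lmodType R) p q (D : 'M[R]_(p, q)) (y : {ffun 'I_p -> K}) : Prop :=
  exists k (U : 'M_(k, p)) (z : {ffun 'I_k -> K}), U *m D = 0 /\ y = vmul z U.

Definition vexact (K : lmodType R) p q (D : 'M[R]_(p, q)) : Prop :=
  forall y : {ffun 'I_p -> K}, vmul y D = 0 -> relation_comb D y.

(* The vanishing of Tor_(n+1) of the cokernel of D with K, when R is coherent. *)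
Fixpoint tor_vanish (K : lmodType R) n p q (D : 'M[R]_(p, q)) : Prop :=
  if n is n'.+1 then
    forall k (U : 'M_(k, p)), mexact U D -> tor_vanish K n' U
  else vexact K D.

Definition fdim_le (K : lmodType R) n : Prop :=
  forall p q (D : 'M[R]_(p, q)), tor_vanish K n D.

(* The equational criterion for flatness. *)
Definition eflat (K : lmodType R) : Prop := fdim_le K 0.

(** Tor_(n+2) of coker [D] is Tor_(n+1) of the cokernel of a syzygy matrix, which is again one of
    the matrices covered by the hypothesis. *)
Lemma fdim_leS (K : lmodType R) n : fdim_le K n -> fdim_le K n.+1.
Proof. by move=> h p q D k U _; apply: h. Qed.

Lemma fdim_le_trans (K : lmodType R) n m : (n <= m)%N -> fdim_le K n -> fdim_le K m.
Proof.
move=> /subnK <-; elim: (m - n)%N => //= k IH h.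
exact/fdim_leS/IH.
Qed.

Section LongExactSequence.
Variables (K1 F K0 : lmodType R) (f : {linear K1 -> F}) (g : {linear F -> K0}).
Hypotheses (f_inj : injective f) (fg : exact_pair f g)
  (g_surj : forall y, exists x, g x = y).

Lemma vker_im p (y : {ffun 'I_p -> F}) : vmap g y = 0 -> exists x, vmap f x = y.
Proof.
move=> h; apply: vmap_surj => i; apply/fg.
by move/ffunP/(_ i): h; rewrite !ffunE.
Qed.

Lemma vmap_gf p (x : {ffun 'I_p -> K1}) : vmap g (vmap f x) = 0.
Proof. by apply/ffunP => i; rewrite !ffunE; apply/fg; exists (x i). Qed.

Lemma vmap_inj p : injective (vmap (p := p) f).
Proof.
by move=> x y /ffunP h; apply/ffunP => i; have := h i; rewrite !ffunE => /f_inj.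
Qed.

(** The piece Tor_(n+2)(F) -> Tor_(n+2)(K0) -> Tor_(n+1)(K1) of the long exact sequence for coker
    [D], whose syzygy is coker [U]. *)
Lemma tor_vanish_quotient n p q k (D : 'M[R]_(p, q)) (U : 'M_(k, p)) :
  mexact U D -> tor_vanish K1 n D -> tor_vanish F n U -> tor_vanish K0 n U.
Proof.
elim: n p q k D U => [|n IH] p q k D U UD /= h1 hF; last first.
  by move=> l V VU; exact: IH VU (h1 _ _ UD) (hF _ _ VU).
move=> y yU.
have [w wE] : exists w, vmap g w = y by apply: vmap_surj => i; apply: g_surj.
have [x xE] : exists x, vmap f x = vmul w U.
  by apply: vker_im; rewrite vmap_mul wE.
(* The connecting map sends [y] to the class of [x]. As this class vanishes, [w] can be corrected by
   an element coming from [K1] to a cycle of [U]. *)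
have [|l [V [z [VD zE]]]] := h1 x.
  by apply: vmap_inj; rewrite vmap_mul xE vmulA UD.1 vmul0 vmap0.
have [W WE] := mexact_lift UD VD.
have [|m [S [v [SU vE]]]] := hF (w - vmap f (vmul z W)).
  rewrite vmulBl -xE zE -vmap_mul vmulA -WE subrr //.
exists m, S, (vmap g v); split=> //.
by rewrite -vmap_mul -vE vmapB wE vmap_gf subr0.
Qed.

Lemma fdim_le_quotient n :
  fdim_le K1 n -> fdim_le F n.+1 -> fdim_le K0 n.+1.
Proof.
move=> h1 hF p q D k U UD.
exact: tor_vanish_quotient UD (h1 _ _ D) (hF _ _ D _ _ UD).
Qed.

(** Dimension shift: Tor_(n+2)(K0) is Tor_(n+1)(K1) because [F] is flat. Coherence provides the
    syzygy matrix at which the hypothesis on [K0] is evaluated. *)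
Lemma tor_vanish_kernel n p q (D : 'M[R]_(p, q)) :
  mcoherent -> eflat F -> tor_vanish K0 n.+1 D -> tor_vanish K1 n D.
Proof.
move=> coh flF; elim: n p q D => [|n IH] p q D h; last first.
  by move=> k U UD; apply/IH/h.
move=> y yD.
have [|k [W [z [WD zE]]]] := flF _ _ D (vmap f y).
  by rewrite -vmap_mul yD vmap0.
have [l [U UD]] := coh _ _ D.
have [W' WE] := mexact_lift UD WD.
have [|m [V [v [VU vE]]]] := h l U UD (vmap g (vmul z W')).
  by rewrite -vmap_mul vmulA -WE -zE vmap_gf.
have [v' v'E] : exists v', vmap g v' = v by apply: vmap_surj => i; apply: g_surj.
have [x xE] : exists x, vmap f x = vmul z W' - vmul v' V.
  by apply: vker_im; rewrite vmapB vE vmap_mul v'E subrr.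
exists l, U, x; split; first exact: UD.1.
by apply: vmap_inj; rewrite vmap_mul xE vmulBl !vmulA VU vmul0 subr0 -WE.
Qed.

End LongExactSequence.

Lemma fdim_le_kernel (K1 F K0 : lmodType R) (f : {linear K1 -> F}) (g : {linear F -> K0}) n :
  injective f -> exact_pair f g -> (forall y, exists x, g x = y) ->
  mcoherent -> eflat F -> fdim_le K0 n.+1 -> fdim_le K1 n.
Proof.
move=> fi fg gs coh flF h p q D.
exact: tor_vanish_kernel fi fg gs _ _ _ _ coh flF (h _ _ D).
Qed.

End Tuples.

(** * Kernels, and the passage from tensor products to matrices *)

Section Kernel.
Variables (R : comNzRingType) (F K : lmodType R) (g : {linear F -> K}).

Definition ker_pred : {pred F} := fun x => g x == 0.

Lemma ker_pred_submod : submod_closed ker_pred.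
Proof.
split; first by rewrite unfold_in linear0.
by move=> a x y /eqP hx /eqP hy; rewrite unfold_in linearP hx hy scaler0 addr0.
Qed.
HB.instance Definition _ := GRing.isSubmodClosed.Build R F ker_pred ker_pred_submod.

Record ker_mod := KerMod { ker_val : F; ker_valP : ker_val \in ker_pred }.
HB.instance Definition _ := [isSub for ker_val].
HB.instance Definition _ := [Choice of ker_mod by <:].
HB.instance Definition _ := [SubChoice_isSubLmodule of ker_mod by <:].

Definition ker_incl : {linear ker_mod -> F} := val : {linear ker_mod -> F}.

Lemma ker_incl_inj : injective ker_incl.
Proof. exact: val_inj. Qed.

Lemma ker_incl_exact : exact_pair ker_incl g.
Proof.
move=> y; split=> [gy | [x <-]]; last exact/eqP/ker_valP.
have yK : y \in ker_pred by apply/eqP.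
by exists (KerMod yK).
Qed.

Section Lift.
Variables (L : lmodType R) (f : {linear L -> F}) (gf : forall x, g (f x) = 0).

Lemma ker_lift_subproof x : f x \in ker_pred.
Proof. exact/eqP. Qed.

Definition ker_lift_fun x := KerMod (ker_lift_subproof x).
Lemma ker_lift_linear : linear ker_lift_fun.
Proof. by move=> a x y; apply: val_inj; rewrite /= linearP. Qed.
Definition ker_lift : {linear L -> ker_mod} :=
  HB.pack ker_lift_fun (GRing.isLinear.Build R L ker_mod *:%R ker_lift_fun ker_lift_linear).

End Lift.

End Kernel.

(** Tensor the exact pair ker g -> R^p -> R^q with [F]. The sum of the y_i (x) e_i becomes zero in
    the last term, so it lifts to F (x) ker g; the finitely many pure tensors of a lift are the
    coefficients and relations sought. *)
Lemma flat_eflat (R : comNzRingType) (F : lmodType R) : flat F -> eflat F.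
Proof.
move=> flF p q D y yD.
pose g : {linear 'rV[R]_p -> 'rV[R]_q} := mulmxr D.
have ex := flF _ _ _ _ _ (ker_incl_exact g).
pose t := tsum [seq (y i, delta_mx 0 i : 'rV[R]_p) | i <- enum 'I_p].
have gt0 : tensor_map F g t = 0.
  rewrite tensor_map_sum -map_comp tsumE big_map big_enum /=.
  rewrite (eq_bigr (fun i => \sum_j pure_tensor (D i j *: y i) (delta_mx 0 j : 'rV[R]_q))).
    rewrite exchange_big big1 //= => j _.
    have -> : \sum_i pure_tensor (D i j *: y i) (delta_mx 0 j : 'rV[R]_q)
      = pure_tensor (vmul y D j) (delta_mx 0 j : 'rV[R]_q).
      rewrite ffunE.
      by elim/big_rec2: _ => [|i u v _ ->]; rewrite ?(bilin0l _ (pure_tensor_bilin _ _))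
        ?(bilinDl _ _ _ (pure_tensor_bilin _ _)).
    by rewrite yD ffunE (bilin0l _ (pure_tensor_bilin _ _)).
  move=> i _; have B := pure_tensor_bilin F 'rV[R]_q.
  rewrite -rowE (row_sum_delta (row i D)).
  elim/big_rec2: _ => [|j u v _ <-]; first exact: bilin0r.
  by rewrite (bilinDr _ _ _ B) (bilinZr _ _ _ B) (bilinZl _ _ _ B) mxE.
have [s sE] := (ex t).1 gt0.
(* This bilinear map reads off coordinates, turning an equality of tensors into one in F^p. *)
pose ev (x : F) (u : 'rV[R]_p) : {ffun 'I_p -> F} := [ffun i => u 0 i *: x].
have evB : bilin ev.
  split=> [x a u v | u a x z]; apply/ffunP => i; rewrite !ffunE.
    by rewrite !mxE scalerDl scalerA.
  by rewrite scalerDr !scalerA mulrC.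
have [f fE _] := tensor_lift evB.
have ftE : f t = y.
  rewrite /t tsumE big_map linear_sum big_enum /=.
  apply/ffunP => j; rewrite sum_ffunE (bigD1 j) //= fE ffunE mxE !eqxx scale1r.
  rewrite big1 ?addr0 // => i /negPf ij; rewrite fE ffunE mxE eqxx /=.
  by rewrite eq_sym ij scale0r.
move: sE; rewrite -(qcls_repr s) [qcls _]/(tsum _) tensor_map_sum.
move: (repr s : seq (F * ker_mod g)) => l lE.
exists (size l), (\matrix_(i < size l) ker_incl g (nth (0, 0) l i).2),
  [ffun i : 'I_(size l) => (nth (0, 0) l i).1]; split.
  apply/row_matrixP => i; rewrite row_mul rowK row0.
  by apply/(ker_incl_exact g); exists (nth (0, 0) l i).2.
rewrite -ftE -lE tsumE big_map linear_sum (big_nth (0, 0)) big_mkord.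
apply/ffunP => j; rewrite sum_ffunE ffunE; apply: eq_bigr => i _.
by rewrite fE !ffunE mxE.
Qed.

(** Induction on the length: the kernel of [e] is resolved by the shifted complex. In length 0 the
    term F_1 is zero, so [e] is bijective and [M] is flat. *)
Lemma flat_dim_fdim (R : comNzRingType) (M : lmodType R) n :
  flat_dim_le M n -> fdim_le M n.
Proof.
move=> [F [d [e [flF F0 es de dd]]]].
elim: n M F d e flF F0 es de dd => [|n IH] M F d e flF F0 es de dd.
  move=> p q D y yD.
  have [x xE] : exists x, vmap e x = y by apply: vmap_surj.
  have [|k [U [z [UD zE]]]] := flat_eflat (flF 0%N) (D := D) (y := x).
    apply/ffunP => j; have : e (vmul x D j) = 0.
      by have := congr1 (fun z : {ffun _} => z j) (vmap_mul e x D); rewrite xE yD !ffunE.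
    by case/de=> w <-; rewrite (F0 1%N isT w) linear0 ffunE.
  by exists k, U, (vmap e z); rewrite -vmap_mul -zE.
refine (fdim_le_quotient (@ker_incl_inj _ _ _ e) (ker_incl_exact e) es _ _); last first.
  exact/(fdim_le_trans (leq0n _))/flat_eflat.
have ed x : e (d 0%N x) = 0 by apply/de; exists x.
apply: (IH _ (fun i => F i.+1) (fun i => d i.+1) (ker_lift ed)) => // [i ni x|y|y].
- exact: F0.
- have [x xE] : exists x, d 0%N x = ker_incl e y.
    by apply/de/(ker_incl_exact e); exists y.
  by exists x; apply: val_inj.
- by rewrite -dd; split=> [/(congr1 (ker_incl e))|h]; [rewrite linear0 | apply: val_inj].
Qed.

(** For one column, the generators of the ideal are compared with those of a finite presentation, as
    in Schanuel's lemma. Further columns are added one at a time. *)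
Lemma coherent_mcoherent (R : comNzRingType) : coherent R -> mcoherent R.
Proof.
move=> coh.
have coh1 p (c : 'cV[R]_p) : exists k (U : 'M_(k, p)), mexact U c.
  pose I := Defs.span (fun i => c i 0 : R^o).
  have [n [f [fI [k [w wE]]]]] : finitely_presented I.
    by apply: coh; exists p, (fun i => c i 0 : R^o).
  have cI i : (c i 0 : R^o) \in I.
    apply/asboolP; exists (fun j => (j == i)%:R).
    rewrite (bigD1 i) //= eqxx scale1r big1 ?addr0 // => j /negPf ji.
    by rewrite ji scale0r.
  have [al alE] := exists_fun (fun i => (fI (c i 0)).1 (cI i)).
  pose A := \matrix_i al i.
  have fIj j : f (delta_mx 0 j) \in I by apply/fI; exists (delta_mx 0 j).
  have [be beE] := exists_fun (fun j => asboolP _ (fIj j)).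
  pose B := \matrix_(j, i) be j i.
  have BE (u : 'rV_n) : u *m B *m c = (f u)%:M.
    apply/rowP => l; rewrite ord1 -mulmxA [RHS]mxE eqxx mulr1n.
    rewrite [in RHS](row_sum_delta u) linear_sum mxE; apply: eq_bigr => j _.
    rewrite linearZ beE /= mxE; congr (_ * _); apply: eq_bigr => i _.
    by rewrite !mxE.
  have AE : A *m B *m c = c.
    apply/row_matrixP => i; rewrite -mulmxA row_mul rowK mulmxA BE alE.
    by apply/rowP => l; rewrite ord1 !mxE eqxx.
  (* As ABc = c, a relation u of c splits as uAB + u(1 - AB), and uA lies in the kernel of [f],
     which the [w i] generate. *)
  exists (k + p)%N, (col_mx ((\matrix_i w i) *m B) (1%:M - A *m B)); split.
    rewrite mul_col_mx mulmxBl mul1mx AE subrr.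
    suff -> : (\matrix_i w i) *m B *m c = 0 by rewrite col_mx0.
    apply/row_matrixP => i; rewrite -mulmxA row_mul rowK mulmxA BE row0.
    have : w i \in Defs.span w.
      apply/asboolP; exists (fun j => (j == i)%:R).
      rewrite (bigD1 i) //= eqxx scale1r big1 ?addr0 // => j /negPf ji.
      by rewrite ji scale0r.
    by rewrite -wE => /eqP ->; apply/rowP => l; rewrite !mxE mul0rn.
  move=> u uc.
  have : u *m A \in Defs.span w.
    rewrite -wE inE; apply/eqP.
    have := BE (u *m A); rewrite -2!mulmxA [A *m _]mulmxA AE uc => /rowP/(_ 0).
    by rewrite !mxE eqxx mulr1n.
  move/asboolP => [v vE]; exists (row_mx (\row_i v i) u).
  rewrite mul_row_col mulmxA.
  have -> : u *m (1%:M - A *m B) = u - (\row_i v i) *m (\matrix_i w i) *m B.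
    rewrite mulmxBr mulmx1 mulmxA vE (mulmx_sum_row (\row_i v i)); congr (_ - _ *m _).
    by apply: eq_bigr => i _; rewrite mxE rowK.
  by rewrite addrC subrK.
move=> p q; elim: q => [|q IH] D.
  exists p, 1%:M; split=> [|u _]; first by apply/matrixP => i [].
  by exists u; rewrite mulmx1.
move: D; rewrite -addn1 => D.
(* A relation of the first q columns is some vU; it also kills the last column exactly when v kills
   [U *m rsubmx D]. *)
have [k [U UD]] := IH (lsubmx D).
have [l [V VU]] := coh1 _ (U *m rsubmx D).
exists l, (V *m U); rewrite -[D]hsubmxK; split.
  rewrite mul_mx_row -mulmxA UD.1 mulmx0 -mulmxA VU.1.
  by rewrite row_mx0.
move=> u; rewrite mul_mx_row -[X in _ = X]row_mx0 => /eq_row_mx[/UD.2[v ->] h].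
by have [|w ->] := VU.2 v; rewrite ?mulmxA //; exists w; rewrite mulmxA.
Qed.

Section Generation.
Variables (R : comNzRingType).

Lemma relation_comb0 (K : lmodType R) p q (D : 'M[R]_(p, q)) :
  relation_comb D (0 : {ffun 'I_p -> K}).
Proof. by exists 0%N, 0, 0; rewrite mul0mx vmul0. Qed.

Lemma relation_combD (K : lmodType R) p q (D : 'M[R]_(p, q)) (y y' : {ffun 'I_p -> K}) :
  relation_comb D y -> relation_comb D y' -> relation_comb D (y + y').
Proof.
move=> [k [U [z [UD ->]]]] [l [V [w [VD ->]]]].
exists (k + l)%N, (col_mx U V),
  [ffun i => match split i with inl a => z a | inr b => w b end]; split.
  by rewrite mul_col_mx UD VD col_mx0.
apply/ffunP => j; rewrite !ffunE big_split_ord /=.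
congr (_ + _); apply: eq_bigr => i _; rewrite ffunE.
  by rewrite (unsplitK (inl i)) col_mxEu.
by rewrite (unsplitK (inr i)) col_mxEd.
Qed.

Lemma relation_comb_map (K L : lmodType R) (f : {linear K -> L}) p q (D : 'M[R]_(p, q))
    (y : {ffun 'I_p -> K}) :
  relation_comb D y -> relation_comb D (vmap f y).
Proof.
by move=> [k [U [z [UD ->]]]]; exists k, U, (vmap f z); rewrite -vmap_mul.
Qed.

Lemma eflat_ring : eflat (R^o : lmodType R).
Proof.
move=> p q D y yD; exists 1%N, (\row_i (y i : R)), [ffun=> 1]; split.
  apply/rowP => j; move/ffunP/(_ j): yD; rewrite !ffunE => yDj.
  rewrite mxE [RHS]mxE -[RHS]yDj.
  by apply: eq_bigr => i _; rewrite mxE /GRing.scale /= mulrC.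
by apply/ffunP => j; rewrite ffunE big_ord1 mxE ffunE /GRing.scale /= mulr1.
Qed.

(** A direct sum of copies of [V], described by injections and projections so as to cover finitely
    supported functions, their restrictions of scalars, and polynomials. A solution is a finite sum
    of solutions lying in single summands. *)
Lemma eflat_sum (I : eqType) (V G : lmodType R)
    (inj : I -> {linear V -> G}) (proj : I -> {linear G -> V}) :
  (forall y, exists s : seq I, forall i, i \notin s -> proj i y = 0) ->
  (forall y s, uniq s -> (forall i, i \notin s -> proj i y = 0) ->
     y = \sum_(i <- s) inj i (proj i y)) ->
  eflat V -> eflat G.
Proof.
move=> fin dec flV p q D y yD.
have [s sP] := exists_fun (fun i => fin (y i)).
pose t := undup (flatten [seq s i | i <- enum 'I_p]).
have tP i j : j \notin t -> proj j (y i) = 0.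
  move=> jt; apply: sP; apply: contra jt => js; rewrite mem_undup.
  by apply/flattenP; exists (s i) => //; apply: map_f; rewrite mem_enum.
have -> : y = \sum_(j <- t) vmap (inj j) (vmap (proj j) y).
  apply/ffunP => i; rewrite sum_ffunE (dec (y i) t (undup_uniq _) (tP i)).
  by apply: eq_bigr => j _; rewrite !ffunE.
elim/big_ind: _ => [||j _]; [exact: relation_comb0 | exact: relation_combD |].
apply/relation_comb_map/flV; rewrite -vmap_mul yD.
exact: vmap0.
Qed.

End Generation.

(** * Change of rings *)

Section FiniteSupport.
Variables (R : comNzRingType) (I : eqType) (V : lmodType R).

Local Notation prodV := (mod_prod (fun _ : I => V)).

Definition fin_supp : {pred prodV} :=
  fun f => `[< exists s : seq I, forall i, i \notin s -> f i = 0 >].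

Lemma fin_supp_submod : submod_closed fin_supp.
Proof.
split; first by apply/asboolP; exists [::].
move=> a f g /asboolP[s sP] /asboolP[t tP]; apply/asboolP; exists (s ++ t) => i.
rewrite mem_cat negb_or => /andP[/sP fi /tP gi].
by rewrite mod_prodD mod_prodZ fi gi scaler0 addr0.
Qed.
HB.instance Definition _ :=
  GRing.isSubmodClosed.Build R prodV fin_supp fin_supp_submod.

Record fsupp := FSupp { fsupp_val : prodV; fsuppP : fsupp_val \in fin_supp }.
HB.instance Definition _ := [isSub for fsupp_val].
HB.instance Definition _ := [Choice of fsupp by <:].
HB.instance Definition _ := [SubChoice_isSubLmodule of fsupp by <:].

Lemma fsupp_eq (f g : fsupp) : (forall i, fsupp_val f i = fsupp_val g i) -> f = g.
Proof. by move=> h; apply: val_inj; apply: mod_prodP. Qed.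

Lemma fsupp_bound (f : fsupp) : exists s : seq I, forall i, i \notin s -> fsupp_val f i = 0.
Proof. exact/asboolP/fsuppP. Qed.

Lemma fsupp_coord_linear i : linear (fun f : fsupp => fsupp_val f i).
Proof. by []. Qed.
Definition fsupp_coord i : {linear fsupp -> V} :=
  HB.pack (fun f : fsupp => fsupp_val f i)
    (GRing.isLinear.Build R fsupp V *:%R _ (fsupp_coord_linear i)).

Lemma delta_fin_supp i x : ((fun j => if j == i then x else 0) : prodV) \in fin_supp.
Proof.
by apply/asboolP; exists [:: i] => j; rewrite inE => /negPf ->.
Qed.
Definition fsupp_delta_fun i x := FSupp (delta_fin_supp i x).
Lemma fsupp_delta_linear i : linear (fsupp_delta_fun i).
Proof.
move=> a x y; apply: fsupp_eq => j /=; rewrite mod_prodD mod_prodZ.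
by case: eqP; rewrite ?scaler0 ?addr0.
Qed.
Definition fsupp_delta i : {linear V -> fsupp} :=
  HB.pack (fsupp_delta_fun i) (GRing.isLinear.Build R V fsupp *:%R _ (fsupp_delta_linear i)).

Lemma fsupp_deltaE i x j : fsupp_val (fsupp_delta i x) j = if j == i then x else 0.
Proof. by []. Qed.

Lemma fsupp_val_sum (J : Type) (r : seq J) (F : J -> fsupp) i :
  fsupp_val (\sum_(j <- r) F j) i = \sum_(j <- r) fsupp_val (F j) i.
Proof. exact: (linear_sum (fsupp_coord i)). Qed.

Lemma fsupp_sum_delta (f : fsupp) (s : seq I) : uniq s ->
  (forall i, i \notin s -> fsupp_val f i = 0) ->
  f = \sum_(i <- s) fsupp_delta i (fsupp_val f i).
Proof.
move=> us sP; apply: fsupp_eq => j; rewrite fsupp_val_sum.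
case: (boolP (j \in s)) => [js | /[dup] js /sP ->].
  rewrite (bigD1_seq j) // fsupp_deltaE eqxx big1 => [|i ij].
    exact/esym/addr0.
  by rewrite fsupp_deltaE eq_sym (negPf ij).
rewrite big_seq big1 // => i iS; rewrite fsupp_deltaE.
by case: eqP => // ji; rewrite ji iS in js.
Qed.

Section Eval.
Variables (W : lmodType R) (e : I -> {linear V -> W}).

(** The support is chosen arbitrarily; [fsupp_eval_funE] gives the independence of the choice. *)
Definition fsupp_eval_fun (f : fsupp) : W :=
  \sum_(i <- undup (projT1 (cid (fsupp_bound f)))) e i (fsupp_val f i).

Lemma fsupp_eval_funE (f : fsupp) (s : seq I) : uniq s ->
  (forall i, i \notin s -> fsupp_val f i = 0) ->
  fsupp_eval_fun f = \sum_(i <- s) e i (fsupp_val f i).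
Proof.
move=> us sP; rewrite /fsupp_eval_fun; case: cid => t tP /=.
rewrite (bigID (fun i => fsupp_val f i == 0)) [RHS](bigID (fun i => fsupp_val f i == 0)) /=.
rewrite [X in X + _]big1 => [|i /eqP ->]; last exact: linear0.
rewrite [X in _ = X + _]big1 => [|i /eqP ->]; last exact: linear0.
rewrite !add0r.
rewrite -big_filter -[RHS]big_filter; apply: perm_big; apply: uniq_perm.
- exact/filter_uniq/undup_uniq.
- exact/filter_uniq.
move=> i; rewrite !mem_filter mem_undup; case: eqP => //= fi.
by rewrite (contra_notT (tP i)) // (contra_notT (sP i)).
Qed.

Lemma fsupp_eval_linear : linear fsupp_eval_fun.
Proof.
move=> a f g; have [s sP] := fsupp_bound f; have [t tP] := fsupp_bound g.
have us := undup_uniq (s ++ t).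
have sP' i : i \notin undup (s ++ t) -> fsupp_val f i = 0.
  by rewrite mem_undup mem_cat negb_or => /andP[/sP].
have tP' i : i \notin undup (s ++ t) -> fsupp_val g i = 0.
  by rewrite mem_undup mem_cat negb_or => /andP[_ /tP].
rewrite (fsupp_eval_funE us sP') (fsupp_eval_funE us tP').
rewrite (fsupp_eval_funE us) => [|i h]; last first.
  by rewrite /= mod_prodD mod_prodZ sP' // tP' // scaler0 addr0.
rewrite scaler_sumr -big_split; apply: eq_bigr => i _ /=.
by rewrite mod_prodD mod_prodZ linearP.
Qed.

Definition fsupp_eval : {linear fsupp -> W} :=
  HB.pack fsupp_eval_fun (GRing.isLinear.Build R fsupp W *:%R _ fsupp_eval_linear).

Lemma fsupp_eval_delta i x : fsupp_eval (fsupp_delta i x) = e i x.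
Proof.
rewrite /= (fsupp_eval_funE (s := [:: i])) ?big_seq1 ?fsupp_deltaE ?eqxx //.
by move=> j; rewrite inE fsupp_deltaE => /negPf ->.
Qed.

End Eval.

Lemma eflat_fsupp : eflat V -> eflat fsupp.
Proof.
apply: (@eflat_sum R I V fsupp fsupp_delta fsupp_coord) => [f|f s us sP].
  exact: fsupp_bound.
exact: fsupp_sum_delta.
Qed.

End FiniteSupport.

Section FreeCover.
Variables (R : comNzRingType) (K : lmodType R).

Definition free_cover : lmodType R := fsupp K (R^o : lmodType R).

Lemma cover_scale_linear (x : K) : linear (fun a : R^o => a *: x).
Proof. by move=> a b c; rewrite scalerDl scalerA. Qed.
Definition cover_scale (x : K) : {linear R^o -> K} :=
  HB.pack (fun a : R^o => a *: x) (GRing.isLinear.Build R R^o K *:%R _ (cover_scale_linear x)).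

Definition cover_map : {linear free_cover -> K} := fsupp_eval cover_scale.

Lemma cover_map_surj x : exists f, cover_map f = x.
Proof.
exists (fsupp_delta R^o x (1 : R^o)); rewrite [LHS]fsupp_eval_delta /=.
exact: scale1r.
Qed.

End FreeCover.

Definition restrict (B C : comNzRingType) (phi : {rmorphism B -> C}) (K : lmodType C) : Type := K.

Section Restriction.
Variables (B C : comNzRingType) (phi : {rmorphism B -> C}).
Local Notation restr := (restrict phi).

Section RestrModule.
Variable K : lmodType C.
HB.instance Definition _ := GRing.Zmodule.on (restr K).
Definition restr_scale b (x : restr K) : restr K := phi b *: (x : K).
Lemma restr_scaleA a b x : restr_scale a (restr_scale b x) = restr_scale (a * b) x.
Proof. by rewrite /restr_scale rmorphM scalerA. Qed.
Lemma restr_scale1 : left_id 1 restr_scale.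
Proof. by move=> x; rewrite /restr_scale rmorph1 scale1r. Qed.
Lemma restr_scaleDr : right_distributive restr_scale +%R.
Proof. by move=> a x y; rewrite /restr_scale scalerDr. Qed.
Lemma restr_scaleDl x : {morph restr_scale^~ x : a b / a + b >-> a + b}.
Proof. by move=> a b; rewrite /restr_scale rmorphD scalerDl. Qed.
HB.instance Definition _ := GRing.Zmodule_isLmodule.Build B (restr K)
  restr_scaleA restr_scale1 restr_scaleDr restr_scaleDl.

Lemma restrZ b (x : restr K) : b *: x = phi b *: (x : K). Proof. by []. Qed.
End RestrModule.

Lemma restr_map_linear (K L : lmodType C) (f : {linear K -> L}) :
  linear (f : restr K -> restr L).
Proof. by move=> a x y; rewrite !restrZ; apply: (linearP f). Qed.
Definition restr_map (K L : lmodType C) (f : {linear K -> L}) : {linear restr K -> restr L} :=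
  HB.pack (f : restr K -> restr L)
    (GRing.isLinear.Build B (restr K) (restr L) *:%R _ (restr_map_linear f)).

Lemma eflat_restr_free (K : lmodType C) :
  eflat (restr C^o : lmodType B) -> eflat (restr (free_cover K) : lmodType B).
Proof.
apply: (@eflat_sum B K (restr C^o) (restr (free_cover K))
  (fun i => restr_map (fsupp_delta C^o i)) (fun i => restr_map (fsupp_coord C^o i))).
  exact: fsupp_bound.
exact: fsupp_sum_delta.
Qed.

(** Induction on [n]: a free cover over C is flat over B, so the syzygy of [K] over C has smaller
    flat dimension over B. Once the syzygy is B-flat, [c] accounts for the rest: 0 for
    localizations, 1 for polynomial rings. *)
Lemma fdim_base_change c n (K : lmodType C) :
  mcoherent B -> eflat (restr C^o : lmodType B) ->
  (forall L : lmodType C, eflat (restr L : lmodType B) -> fdim_le L c) ->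
  fdim_le (restr K : lmodType B) n -> fdim_le K (n + c).
Proof.
move=> coh flC base; elim: n K => [|n IH] K h; first exact: base.
have gs := @cover_map_surj C K; have gi := @ker_incl_inj _ _ _ (cover_map K).
have ge := ker_incl_exact (cover_map K).
refine (fdim_le_quotient gi ge gs _ _); last first.
  exact/(fdim_le_trans (leq0n _))/eflat_fsupp/eflat_ring.
apply: IH; refine (@fdim_le_kernel B _ _ _ (restr_map (ker_incl (cover_map K)))
  (restr_map (cover_map K)) n gi ge gs coh _ h).
exact: eflat_restr_free.
Qed.

End Restriction.

(** * Localization as a change of rings *)

Section LocalizationMorphism.
Variables (B C : comNzRingType) (phi : {rmorphism B -> C}) (S : B -> Prop).

(** The characteristic properties of S^-1 B. An isomorphism is the case S = {1}, so that transport
    along isomorphisms is an instance too. *)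
Record is_localization : Prop := IsLocalization {
  isloc1 : S 1;
  islocM : forall s t, S s -> S t -> S (s * t);
  isloc_unit : forall s, S s -> exists t, t * phi s = 1;
  isloc_frac : forall c, exists s, S s /\ exists x, phi s * c = phi x;
  isloc_ker : forall x, phi x = 0 -> exists s, S s /\ s * x = 0 }.

Hypothesis loc : is_localization.

Lemma isloc_prod (I : finType) (s : I -> B) (P : pred I) :
  (forall i, S (s i)) -> S (\prod_(i | P i) s i).
Proof.
by move=> h; elim/big_ind: _ => [||i _]; [exact: isloc1 | exact: islocM |].
Qed.

Lemma isloc_common_frac (I : finType) (f : I -> C) :
  exists s, S s /\ exists g : I -> B, forall i, phi s * f i = phi (g i).
Proof.
have [s sP] := exists_fun (fun i => isloc_frac loc (f i)).
have [x xE] := exists_fun (fun i => (sP i).2).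
exists (\prod_i s i); split; first by apply: isloc_prod => i; case: (sP i).
exists (fun i => \prod_(j | j != i) s j * x i) => i.
rewrite (bigD1 i) //= [in RHS]rmorphM -(xE i) [in LHS]rmorphM.
by rewrite mulrCA mulrA.
Qed.

Lemma isloc_common_ker (I : finType) (g : I -> B) : (forall i, phi (g i) = 0) ->
  exists s, S s /\ forall i, s * g i = 0.
Proof.
move=> h; have [s sP] := exists_fun (fun i => isloc_ker loc (h i)).
exists (\prod_i s i); split; first by apply: isloc_prod => i; case: (sP i).
by move=> i; rewrite (bigD1 i) //= mulrAC (sP i).2 mul0r.
Qed.

Lemma isloc_frac_mx p q (M : 'M[C]_(p, q)) :
  exists s, S s /\ exists M', phi s *: M = map_mx phi M'.
Proof.
have [s [sS [g gE]]] := isloc_common_frac (fun ij : 'I_p * 'I_q => M ij.1 ij.2).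
exists s; split=> //; exists (\matrix_(i, j) g (i, j)).
by apply/matrixP => i j; rewrite !mxE -gE.
Qed.

Lemma isloc_ker_mx p q (M : 'M[B]_(p, q)) : map_mx phi M = 0 ->
  exists s, S s /\ s *: M = 0.
Proof.
move=> /matrixP h.
have [|s [sS sM]] := @isloc_common_ker _ (fun ij : 'I_p * 'I_q => M ij.1 ij.2).
  by move=> [i j] /=; have := h i j; rewrite !mxE.
by exists s; split=> //; apply/matrixP => i j; rewrite !mxE; apply: (sM (i, j)).
Qed.

(** Denominators are cleared twice: once to bring [u] into B, and once more to make a relation that
    holds in C hold in B. *)
Lemma isloc_rel p q (u : 'rV[C]_p) (D : 'M[B]_(p, q)) : u *m map_mx phi D = 0 ->
  exists s t, [/\ S s, t * phi s = 1 &
    exists v : 'rV_p, u = t *: map_mx phi v /\ v *m D = 0].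
Proof.
move=> uD; have [s [sS [v vE]]] := isloc_frac_mx u.
have [|s' [s'S vD]] := @isloc_ker_mx _ _ (v *m D).
  by rewrite map_mxM -vE -scalemxAl uD scaler0.
have ss := islocM loc s'S sS; have [t tE] := isloc_unit loc ss.
exists (s' * s), t; split=> //; exists (s' *: v); split; last by rewrite -scalemxAl.
by rewrite map_mxZ -vE !scalerA -mulrA -rmorphM tE scale1r.
Qed.

Lemma isloc_eflat : eflat (restrict phi C^o : lmodType B).
Proof.
move=> p q D y yD.
have [|s [t [sS ts [v [vE vD]]]]] := @isloc_rel p q (\row_i (y i : C)) D.
  apply/rowP => j; move/ffunP/(_ j): yD; rewrite !ffunE => yDj.
  by rewrite [LHS]mxE [RHS]mxE -[RHS]yDj; apply: eq_bigr => i _; rewrite !mxE mulrC.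
exists 1%N, v, [ffun=> t]; split=> //.
apply/ffunP => j; rewrite ffunE big_ord1 ffunE restrZ.
by move/rowP/(_ j): vE; rewrite !mxE /GRing.scale /= => ->; rewrite mulrC.
Qed.

Lemma isloc_mcoherent : mcoherent B -> mcoherent C.
Proof.
move=> coh p q D; have [s [sS [D' D'E]]] := isloc_frac_mx D.
have [k [U [UD ex]]] := coh _ _ D'; exists k, (map_mx phi U); split.
  have [t tE] := isloc_unit loc sS.
  have : phi s *: (map_mx phi U *m D) = 0.
    by rewrite scalemxAr D'E -map_mxM UD map_mx0.
  by move/(congr1 (fun M => t *: M)); rewrite scalerA tE scale1r scaler0.
move=> u uD; have [|s' [t [s'S ts [v [-> /ex[w ->]]]]]] := @isloc_rel _ _ u D'.
  by rewrite -D'E -scalemxAr uD scaler0.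
by exists (t *: map_mx phi w); rewrite map_mxM scalemxAl.
Qed.

Lemma isloc_eflat_restr (L : lmodType C) : eflat (restrict phi L : lmodType B) -> eflat L.
Proof.
move=> flL p q D y yD; have [s [sS [D' D'E]]] := isloc_frac_mx D.
have [|k [U [z [UD zE]]]] := flL _ _ D' (y : {ffun 'I_p -> restrict phi L}).
  apply/ffunP => j; move/ffunP/(_ j): yD; rewrite !ffunE => yDj.
  transitivity (phi s *: \sum_i D i j *: y i); last by rewrite yDj scaler0.
  rewrite scaler_sumr; apply: eq_bigr => i _.
  by rewrite scalerA restrZ; move/matrixP/(_ i j): D'E; rewrite !mxE => ->.
exists k, (map_mx phi U), z; split.
  have [t tE] := isloc_unit loc sS.
  have : phi s *: (map_mx phi U *m D) = 0.
    by rewrite scalemxAr D'E -map_mxM UD map_mx0.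
  by move/(congr1 (fun M => t *: M)); rewrite scalerA tE scale1r scaler0.
apply/ffunP => i; move/ffunP/(_ i): zE; rewrite !ffunE => ->.
by apply: eq_bigr => l _; rewrite mxE.
Qed.

Lemma isloc_fdim n : mcoherent B -> (forall K : lmodType B, fdim_le K n) ->
  forall L : lmodType C, fdim_le L n.
Proof.
move=> coh h L; rewrite -[n]addn0.
apply: (fdim_base_change (phi := phi)) => //; first exact: isloc_eflat.
exact: isloc_eflat_restr.
Qed.

End LocalizationMorphism.

Lemma isloc_bij (B C : comNzRingType) (phi : {rmorphism B -> C}) :
  injective phi -> (forall c, exists b, phi b = c) -> is_localization phi (eq 1).
Proof.
move=> inj surj; split=> //.
- by move=> s t <- <-; rewrite mulr1.
- by move=> s <-; exists 1; rewrite rmorph1 mulr1.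
- by move=> c; have [b <-] := surj c; exists 1; split=> //; exists b; rewrite rmorph1 mul1r.
- by move=> x x0; exists 1; split=> //; rewrite mul1r; apply: inj; rewrite x0 rmorph0.
Qed.

Definition endomod (B : comNzRingType) (G : lmodType B) (s : {linear G -> G}) : Type := G.

(** * Hilbert's syzygy theorem *)

Section EndomorphismModule.
Variables (B : comNzRingType) (G : lmodType B) (s : {linear G -> G}).
Local Notation endo_mod := (endomod s).

HB.instance Definition _ := GRing.Zmodule.on endo_mod.

(** The action of p(s): the variable acts on [G] through [s]. *)
Definition endo_scale (p : {poly B}) (v : G) : G := \sum_(i < size p) p`_i *: iter i s v.

Lemma endo_scale_widen n (p : {poly B}) v : (size p <= n)%N ->
  endo_scale p v = \sum_(i < n) p`_i *: iter i s v.
Proof.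
move=> le_pn; rewrite /endo_scale -!(big_mkord xpredT (fun i => p`_i *: iter i s v)).
rewrite (big_cat_nat (leq0n _) le_pn) /= [X in _ + X]big_nat_cond [X in _ + X]big1 ?addr0 //.
by move=> i /andP[/andP[h _] _]; rewrite nth_default // scale0r.
Qed.

Lemma endo_scaleDl v : {morph endo_scale^~ v : p q / p + q}.
Proof.
move=> p q; pose n := maxn (size p) (size q).
rewrite !(endo_scale_widen (n := n)) ?leq_maxl ?leq_maxr ?size_polyD //.
by rewrite -big_split; apply: eq_bigr => i _; rewrite coefD scalerDl.
Qed.

Lemma endo_scaleDr : right_distributive endo_scale +%R.
Proof.
move=> p u v; rewrite -big_split; apply: eq_bigr => i _ /=; rewrite -scalerDr.
by congr (_ *: _); elim: (i : nat) => //= n ->; rewrite linearD.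
Qed.

Lemma endo_scaleC c v : endo_scale c%:P v = c *: v.
Proof. by rewrite (endo_scale_widen _ (size_polyC_leq1 c)) big_ord1 coefC. Qed.

Lemma endo_scaleMX p v : endo_scale (p * 'X) v = s (endo_scale p v).
Proof.
rewrite (@endo_scale_widen (size p).+1); last first.
  by apply: leq_trans (size_polyMleq _ _) _; rewrite size_polyX addn2.
rewrite big_ord_recl coefMX scale0r add0r linear_sum; apply: eq_bigr => i _.
by rewrite coefMX linearZ.
Qed.

Lemma endo_scaleA p q v : endo_scale p (endo_scale q v) = endo_scale (p * q) v.
Proof.
elim/poly_ind: p => [|p c IH]; first by rewrite mul0r /endo_scale size_poly0 !big_ord0.
rewrite mulrDl !endo_scaleDl endo_scaleC endo_scaleMX IH mulrAC endo_scaleMX.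
congr (_ + _); rewrite mul_polyC [RHS](@endo_scale_widen (size q)) ?size_scale_leq //.
by rewrite scaler_sumr; apply: eq_bigr => i _; rewrite coefZ scalerA.
Qed.

Lemma endo_scale1 : left_id 1 endo_scale.
Proof. by move=> v; rewrite -[1]/(1%:P) endo_scaleC scale1r. Qed.

HB.instance Definition _ := GRing.Zmodule_isLmodule.Build {poly B} endo_mod
  endo_scaleA endo_scale1 endo_scaleDr endo_scaleDl.

Lemma endo_modZ (p : {poly B}) (v : endo_mod) : p *: v = endo_scale p v.
Proof. by []. Qed.

Lemma endo_linear (L : lmodType {poly B}) (f : {linear G -> restrict (@polyC B) L}) :
  (forall v, f (s v) = 'X *: (f v : L)) -> linear (f : endo_mod -> L).
Proof.
move=> fs p u v; rewrite [LHS](linearD f); congr (_ + _).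
rewrite endo_modZ; elim/poly_ind: p => [|p c IH].
  by rewrite scale0r /endo_scale size_poly0 big_ord0 [LHS](linear0 f).
rewrite endo_scaleDl endo_scaleC endo_scaleMX [LHS](linearD f) [X in X + _]fs.
by rewrite [X in _ *: X]IH [X in _ + X](linearZ_LR f) scalerDl mulrC scalerA.
Qed.

End EndomorphismModule.

Lemma eflat_finType (R : comNzRingType) (K : lmodType R) (I J : finType)
    (D : I -> J -> R) (y : I -> K) :
  eflat K -> (forall j, \sum_i D i j *: y i = 0) ->
  exists k (U : 'I_k -> I -> R) (z : 'I_k -> K),
    (forall l j, \sum_i U l i * D i j = 0) /\ (forall i, y i = \sum_l U l i *: z l).
Proof.
move=> flK yD.
have sumE (V : zmodType) (f : I -> V) : \sum_i f i = \sum_(i < #|I|) f (enum_val i).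
  by rewrite (reindex (@enum_val I I)) //; apply: onW_bij; apply: enum_val_bij.
have [|k [U [z [UD zE]]]] := flK _ _ (\matrix_(i < #|I|, j < #|J|) D (enum_val i) (enum_val j))
    [ffun i => y (enum_val i)].
  apply/ffunP => j; rewrite !ffunE -[RHS](yD (enum_val j)) sumE.
  by apply: eq_bigr => i _; rewrite mxE ffunE.
exists k, (fun l i => U l (enum_rank i)), z; split=> [l j | i].
  move/matrixP/(_ l (enum_rank j)): UD; rewrite !mxE => h.
  rewrite -[RHS]h sumE; apply: eq_bigr => i _.
  by rewrite mxE enum_valK enum_rankK.
by move/ffunP/(_ (enum_rank i)): zE; rewrite !ffunE enum_rankK.
Qed.

Section PolynomialModule.
Variables (B : comNzRingType) (V : lmodType B).

Local Notation G := (fsupp nat V).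
Local Notation delta := (@fsupp_delta B nat V).

Definition shift : {linear G -> G} := fsupp_eval (fun i => delta i.+1).

#[global] Arguments shift : simpl never.

Lemma shift_delta i x : shift (delta i x) = delta i.+1 x.
Proof. exact: fsupp_eval_delta. Qed.

Lemma fsupp_linear_ext (W : lmodType B) (f g : {linear G -> W}) :
  (forall i x, f (delta i x) = g (delta i x)) -> f =1 g.
Proof.
move=> h v; have [s sP] := fsupp_bound v.
rewrite (@fsupp_sum_delta _ _ _ v _ (undup_uniq s)) => [|i]; last by rewrite mem_undup => /sP.
by rewrite !linear_sum; apply: eq_bigr => i _.
Qed.

Lemma iter_shift_delta k i x : iter k shift (delta i x) = delta (k + i)%N x.
Proof. by elim: k => // k IH; rewrite iterS IH shift_delta. Qed.

Lemma fsupp_nat_bound (f : G) : exists d, forall k, (d <= k)%N -> fsupp_val f k = 0.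
Proof.
have [s sP] := fsupp_bound f; exists (\max_(i <- s) i).+1 => k dk.
apply: sP; apply/negP => ks; move: dk; rewrite ltnNge => /negP; apply.
exact: leq_bigmax_seq.
Qed.

Lemma fsupp_nat_sum (f : G) d : (forall k, (d <= k)%N -> fsupp_val f k = 0) ->
  f = \sum_(k < d) delta k (fsupp_val f k).
Proof.
move=> h; rewrite -(big_mkord xpredT (fun k => delta k (fsupp_val f k))).
apply: fsupp_sum_delta; first exact: iota_uniq.
by move=> k; rewrite mem_index_iota /= -leqNgt => /h.
Qed.

Local Notation GX := (endomod shift).

Lemma endo_scale_delta (p : {poly B}) k x t :
  fsupp_val (p *: (delta k x : GX) : GX) t = ('X^k * p)`_t *: x.
Proof.
rewrite endo_modZ /endo_scale fsupp_val_sum coefXnM.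
under eq_bigr do rewrite iter_shift_delta -linearZ_LR fsupp_deltaE.
case: ltnP => [tk | kt].
  rewrite scale0r big1 // => i _; case: eqP => // ti.
  by move: tk; rewrite ti ltnNge leq_addl.
case: (ltnP (t - k) (size p)) => [h | h].
  rewrite (bigD1 (Ordinal h)) //= subnK // eqxx big1 ?addr0 // => i /eqP ih.
  case: eqP => // ti; case: ih; apply: val_inj => /=.
  by rewrite ti addnK.
rewrite nth_default // scale0r big1 // => i _; case: eqP => // ti.
by move: h; rewrite ti addnK leqNgt ltn_ord.
Qed.

Lemma endo_scale_val (p : {poly B}) (f : GX) d t :
  (forall k, (d <= k)%N -> fsupp_val (f : G) k = 0) ->
  fsupp_val (p *: f : GX) t = \sum_(k < d) ('X^k * p)`_t *: fsupp_val (f : G) k.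
Proof.
move=> h; rewrite {1}(fsupp_nat_sum h) endo_modZ.
rewrite (@big_morph _ _ (endo_scale shift p) 0 +%R 0 +%R); first last.
- by rewrite -endo_modZ scaler0.
- exact: endo_scaleDr.
by rewrite fsupp_val_sum; apply: eq_bigr => k _; rewrite -endo_scale_delta.
Qed.

(** A linear system over B[X] with a solution in V[X] of bounded degree is a system over B for the
    coefficients. The relations found over B are reassembled into polynomials, and the new elements
    are constants of V[X]. *)
Lemma eflat_polymod : eflat V -> eflat (GX : lmodType {poly B}).
Proof.
move=> flV p q D y yD.
have [d' d'P] := exists_fun (fun i => fsupp_nat_bound (y i)).
(* [d] exceeds the degrees of all [y i], and [e] those of all ['X^k * D i j] with k < d. *)
pose d := \max_i d' i; pose e := (d + \max_i \max_j size (D i j))%N.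
have dP i k : (d <= k)%N -> fsupp_val (y i : G) k = 0.
  by move=> dk; apply: d'P; apply: leq_trans dk; apply: (leq_bigmax i).
have [|k [U [z [UD zE]]]] := @eflat_finType B V ('I_p * 'I_d)%type ('I_q * 'I_e)%type
   (fun ik jt => ('X^(ik.2) * D ik.1 jt.1)`_jt.2) (fun ik => fsupp_val (y ik.1 : G) ik.2) flV.
  move=> [j t] /=.
  rewrite -(pair_bigA _ (fun (i : 'I_p) (k : 'I_d) =>
    ('X^k * D i j)`_t *: fsupp_val (y i) k)) /=.
  move/ffunP/(_ j): yD; rewrite !ffunE => /(congr1 (fun f : G => fsupp_val f t)).
  rewrite fsupp_val_sum => h; rewrite -[RHS]h; apply: eq_bigr => i _.
  by rewrite (endo_scale_val _ _ (dP i)).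
exists k, (\matrix_(l, i) \sum_(k < d) U l (i, k) *: 'X^k), [ffun l => delta 0 (z l)].
split.
  apply/matrixP => l j; rewrite mxE [RHS]mxE; apply/polyP => t; rewrite coef_sum coef0.
  under eq_bigr => i _.
    rewrite mxE mulr_suml coef_sum.
    under eq_bigr do rewrite -scalerAl coefZ.
    over.
  case: (ltnP t e) => [te | et].
    rewrite -[RHS](UD l (j, Ordinal te)).
    by rewrite pair_bigA; apply: eq_bigr => -[i s] _.
  rewrite big1 // => i _; rewrite big1 // => s _.
  rewrite coefXnM; case: ltnP => // _; first by rewrite mulr0.
  rewrite nth_default ?mulr0 // leq_subRL; last first.
    by rewrite (leq_trans _ et) // ltnW // ltn_addr.
  rewrite (leq_trans _ et) // leq_add //; first exact: ltnW.
  by rewrite (leq_trans _ (leq_bigmax i)) //; apply: (leq_bigmax j).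
apply/ffunP => i; rewrite ffunE; apply: fsupp_eq => t; rewrite fsupp_val_sum.
under eq_bigr do rewrite mxE ffunE endo_scale_delta expr0 mul1r coef_sum.
case: (ltnP t d) => [td | dt].
  rewrite (zE (i, Ordinal td)); apply: eq_bigr => l _; congr (_ *: _).
  rewrite (bigD1 (Ordinal td)) //= coefZ coefXn eqxx mulr1 big1 ?addr0 // => s /eqP sd.
  rewrite coefZ coefXn; case: eqP => [ts|_]; last by rewrite mulr0.
  by case: sd; apply: val_inj.
rewrite dP // big1 // => l _; rewrite big1 ?scale0r // => s _.
by rewrite coefZ coefXn gtn_eqF ?mulr0 // (leq_trans (ltn_ord s)).
Qed.

End PolynomialModule.

Section PolynomialResolution.
Variables (B : comNzRingType) (L : lmodType {poly B}).

Local Notation V := (restrict (@polyC B) L).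
Local Notation G := (fsupp nat V).
Local Notation delta := (@fsupp_delta B nat V).
Local Notation GX := (endomod (shift V)).
Local Arguments fsupp_delta : simpl never.

Lemma mulXn_linear k : linear (fun x : V => 'X^k *: (x : L) : V).
Proof. by move=> a x y; rewrite !restrZ scalerDr !scalerA mulrC. Qed.
Definition mulXn k : {linear V -> V} :=
  HB.pack (fun x : V => 'X^k *: (x : L) : V) (GRing.isLinear.Build B V V *:%R _ (mulXn_linear k)).

Definition poly_eval : {linear G -> V} := fsupp_eval mulXn.

Arguments poly_eval : simpl never.

Lemma poly_eval_delta i x : poly_eval (delta i x) = 'X^i *: (x : L).
Proof. exact: fsupp_eval_delta. Qed.

Lemma poly_eval_shift v : poly_eval (shift V v) = 'X *: (poly_eval v : L).
Proof.
pose f : {linear G -> V} := poly_eval \o shift V.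
pose g : {linear G -> V} := mulXn 1 \o poly_eval.
apply: (@fsupp_linear_ext _ _ _ f g) => i x.
rewrite -[LHS]/(poly_eval (shift V (delta i x))) shift_delta.
rewrite -[RHS]/('X *: (poly_eval (delta i x) : L)) !poly_eval_delta.
by rewrite scalerA -exprS.
Qed.

Definition mul_coef : {linear G -> G} := fsupp_eval (fun i => delta i \o mulXn 1).

Arguments mul_coef : simpl never.

Lemma mul_coef_delta i x : mul_coef (delta i x) = delta i ('X *: (x : L)).
Proof. by rewrite [LHS]fsupp_eval_delta /= expr1. Qed.

Lemma mul_coef_val f i : fsupp_val (mul_coef f) i = 'X *: (fsupp_val f i : L).
Proof.
pose h : {linear G -> V} := fsupp_coord V i \o mul_coef.
pose g : {linear G -> V} := mulXn 1 \o fsupp_coord V i.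
apply: (@fsupp_linear_ext _ _ _ h g) => j x.
rewrite -[LHS]/(fsupp_val (mul_coef (delta j x)) i) mul_coef_delta fsupp_deltaE.
rewrite -[RHS]/('X *: (fsupp_val (delta j x) i : L)) fsupp_deltaE.
by case: eqP; rewrite ?scaler0.
Qed.

(** This is X (x) 1 - 1 (x) X on B[X] (x) V. Together with [poly_eval] it gives the resolution 0 ->
    L[X] -> L[X] -> L -> 0 over B[X]. *)
Definition shift_sub : {linear G -> G} := (shift V \- mul_coef).

Lemma shift_sub_delta i x :
  shift_sub (delta i x) = delta i.+1 x - delta i ('X *: (x : L)).
Proof.
rewrite -[LHS]/(shift V (delta i x) - mul_coef (delta i x)).
by rewrite shift_delta mul_coef_delta.
Qed.

Lemma shift_sub_shift v : shift_sub (shift V v) = shift V (shift_sub v).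
Proof.
pose f : {linear G -> G} := shift_sub \o shift V.
pose g : {linear G -> G} := shift V \o shift_sub.
apply: (@fsupp_linear_ext _ _ _ f g) => i x.
rewrite -[LHS]/(shift_sub (shift V (delta i x))) shift_delta.
rewrite -[RHS]/(shift V (shift_sub (delta i x))) !shift_sub_delta.
by rewrite linearB !shift_delta.
Qed.

Lemma shift_valS f i : fsupp_val (shift V f) i.+1 = fsupp_val f i.
Proof.
pose h : {linear G -> V} := fsupp_coord V i.+1 \o shift V.
apply: (@fsupp_linear_ext _ _ _ h (fsupp_coord V i)) => j x.
rewrite -[LHS]/(fsupp_val (shift V (delta j x)) i.+1) shift_delta.
by rewrite -[RHS]/(fsupp_val (delta j x) i) !fsupp_deltaE eqSS.
Qed.

(** The coefficients of an element of the kernel satisfy w_k = X w_(k+1) and vanish in high degrees,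
    hence in all degrees. *)
Lemma shift_sub_inj : injective shift_sub.
Proof.
move=> u v uv; apply/eqP; rewrite -subr_eq0; apply/eqP.
have : shift_sub (u - v) = 0 by rewrite linearB uv subrr.
move: (u - v) => w h.
have step k : fsupp_val w k = 'X *: (fsupp_val w k.+1 : L).
  move: h => /(congr1 (fun f : G => fsupp_val f k.+1)).
  rewrite -[LHS]/(fsupp_val (shift V w) k.+1 - fsupp_val (mul_coef w) k.+1).
  by rewrite shift_valS mul_coef_val => /eqP; rewrite subr_eq0 => /eqP.
have [d dP] := fsupp_nat_bound w.
apply: fsupp_eq => k; have [m] : exists m, (d <= k + m)%N by exists d; rewrite leq_addl.
elim: m k => [|m IH] k; first by rewrite addn0 => /dP.
by rewrite addnS -addSn => /IH h'; rewrite step h' scaler0.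
Qed.

Lemma shift_sub_exact v : poly_eval v = 0 <-> exists w, shift_sub w = v.
Proof.
split=> [v0 | [w <-]]; last first.
  pose f : {linear G -> V} := poly_eval \o shift_sub.
  pose g : {linear G -> V} := \0.
  apply: (@fsupp_linear_ext _ _ _ f g) => i x.
  rewrite -[LHS]/(poly_eval (shift_sub (delta i x))) shift_sub_delta linearB.
  rewrite !poly_eval_delta.
  by rewrite scalerA -exprSr subrr.
(* Modulo the image, X^i (x) x equals 1 (x) X^i x, so every element reduces to its value under
   [poly_eval], placed in degree 0. *)
have red i x : exists w, delta i x - delta 0 ('X^i *: (x : L)) = shift_sub w.
  elim: i x => [|i IH] x; first by exists 0; rewrite expr0 scale1r subrr linear0.
  have [w wE] := IH ('X *: (x : L)); exists (delta i x + w).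
  by rewrite linearD shift_sub_delta -wE addrA subrK scalerA -exprSr.
have [d dP] := fsupp_nat_bound v.
have [w wE] := exists_fun (fun i : 'I_d => red i (fsupp_val v i)).
exists (\sum_i w i); rewrite linear_sum.
under eq_bigr do rewrite -wE.
rewrite sumrB -fsupp_nat_sum //.
rewrite -[X in _ - X](linear_sum (delta 0)).
suff -> : \sum_(i < d) 'X^i *: (fsupp_val v i : L) = poly_eval v by rewrite v0 linear0 subr0.
rewrite {2}(fsupp_nat_sum dP) linear_sum; apply: eq_bigr => i _.
by rewrite poly_eval_delta.
Qed.

Lemma fdim_poly : eflat (V : lmodType B) -> fdim_le L 1.
Proof.
move=> flV; have flG := eflat_polymod flV.
have lin_ev := endo_linear poly_eval_shift.
pose ev : {linear GX -> L} := HB.pack (poly_eval : GX -> L)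
  (GRing.isLinear.Build {poly B} GX L *:%R (poly_eval : GX -> L) lin_ev).
have lin_sub : linear (shift_sub : GX -> GX).
  move=> p u v; rewrite [LHS](linearD shift_sub); congr (_ + _).
  rewrite !endo_modZ /endo_scale linear_sum; apply: eq_bigr => i _.
  have iter_sub k : shift_sub (iter k (shift V) u) = iter k (shift V) (shift_sub u).
    by elim: k => // k IH; rewrite !iterS shift_sub_shift IH.
  by rewrite -iter_sub; apply: (linearZ_LR shift_sub).
pose sub : {linear GX -> GX} := HB.pack (shift_sub : GX -> GX)
  (GRing.isLinear.Build {poly B} GX GX *:%R (shift_sub : GX -> GX) lin_sub).
refine (@fdim_le_quotient _ _ _ _ sub ev shift_sub_inj shift_sub_exact _ _ flG (fdim_leS flG)).
move=> x; exists (delta 0 x).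
by rewrite [LHS]poly_eval_delta expr0 scale1r.
Qed.

End PolynomialResolution.

Lemma eflat_poly (B : comNzRingType) :
  eflat (restrict (@polyC B) {poly B}^o : lmodType B).
Proof.
have mon_lin i : linear (fun b : B^o => b *: 'X^i : restrict (@polyC B) {poly B}^o).
  move=> a b c; rewrite scalerDl -scalerA; congr (_ + _).
  by rewrite restrZ /GRing.scale /= mul_polyC.
have coef_lin i : linear (fun p : restrict (@polyC B) {poly B}^o => (p : {poly B})`_i : B^o).
  by move=> a p q; rewrite coefD restrZ coefCM.
apply: (@eflat_sum B nat B^o _
   (fun i => HB.pack (fun b : B^o => b *: 'X^i : restrict (@polyC B) {poly B}^o)
      (GRing.isLinear.Build _ _ _ _ _ (mon_lin i)))
   (fun i => HB.pack (fun p : restrict (@polyC B) {poly B}^o => (p : {poly B})`_i : B^o)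
      (GRing.isLinear.Build _ _ _ _ _ (coef_lin i)))); last exact: eflat_ring.
  move=> p; exists (iota 0 (size (p : {poly B}))) => i /=.
  by rewrite mem_iota /= -leqNgt => /(nth_default 0) ->.
move=> p s us sP /=; apply/polyP => j; rewrite coef_sum.
under eq_bigr do rewrite coefZ coefXn.
case: (boolP (j \in s)) => [js | /[dup] js /sP /= ->].
  rewrite (bigD1_seq j) //= eqxx mulr1 big1 ?addr0 // => i ij.
  by rewrite eq_sym (negPf ij) mulr0.
rewrite big_seq big1 // => i iS; case: eqP => [ji|_]; last by rewrite mulr0.
by rewrite ji iS in js.
Qed.

Lemma fdim_poly_ring (B : comNzRingType) n : mcoherent B ->
  (forall K : lmodType B, fdim_le K n) -> forall L : lmodType {poly B}, fdim_le L n.+1.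
Proof.
move=> coh h L; rewrite -addn1.
apply: (fdim_base_change (phi := @polyC B)) => //; first exact: eflat_poly.
exact: fdim_poly.
Qed.

(** * Multivariate polynomials as iterated univariate ones *)

Section MpolyIso.
Variables (A : comNzRingType) (n : nat).

Definition mpoly_of_poly : {rmorphism {poly {mpoly A[n]}} -> {mpoly A[n.+1]}} :=
  horner_morph (fun p => mulrC 'X_ord_max (mwiden p)).

Lemma muniX_max : muni ('X_ord_max : {mpoly A[n.+1]}) = 'X.
Proof.
rewrite muniE msuppX big_seq1 mcoeffX eqxx mnm1E eqxx expr1.
suff -> : [multinom (U_(ord_max)%MM : 'X_{1..n.+1}) (widen_ord (leqnSn n) i) | i < n] = 0%MM.
  by rewrite mpolyX0 !scale1r.
by apply/mnmP => i; rewrite !mnmE -val_eqE /= gtn_eqF.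
Qed.

Lemma muniX_widen (i : 'I_n) :
  muni ('X_(widen_ord (leqnSn n) i) : {mpoly A[n.+1]}) = ('X_i)%:P.
Proof.
rewrite muniE msuppX big_seq1 mcoeffX eqxx mnm1E -val_eqE /= ltn_eqF // expr0.
suff -> : [multinom (U_(widen_ord (leqnSn n) i)%MM : 'X_{1..n.+1}) (widen_ord (leqnSn n) j) | j < n]
   = U_(i)%MM by rewrite scale1r alg_polyC.
by apply/mnmP => j; rewrite !mnmE -!val_eqE.
Qed.

Lemma mpoly_morph_ext k (C : comNzRingType) (f g : {rmorphism {mpoly A[k]} -> C}) :
  (forall c, f c%:MP = g c%:MP) -> (forall i, f 'X_i = g 'X_i) -> f =1 g.
Proof.
move=> fgC fgX p; rewrite [p]mpolyE !rmorph_sum; apply: eq_bigr => m _.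
rewrite -mul_mpolyC !rmorphM fgC mpolyXE_id; congr (_ * _).
by rewrite !rmorph_prod; apply: eq_bigr => i _; rewrite !rmorphXn /= fgX.
Qed.

Lemma muniK : cancel (@muni n A) mpoly_of_poly.
Proof.
apply: (@mpoly_morph_ext _ _ (mpoly_of_poly \o @muni n A) idfun) => [c|i] /=.
  by rewrite muniC [LHS]horner_morphC [LHS]/= mwidenC.
case: (unliftP ord_max i) => [j ->|->]; last by rewrite muniX_max [LHS]horner_morphX.
have -> : lift ord_max j = widen_ord (leqnSn n) j.
  by apply: val_inj; rewrite /= /bump leqNgt ltn_ord.
by rewrite muniX_widen [LHS]horner_morphC [LHS]/= mwidenX mnmwiden1.
Qed.

Lemma muni_mwiden (p : {mpoly A[n]}) : muni (mwiden p) = p%:P.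
Proof.
apply: (@mpoly_morph_ext _ _ (@muni n A \o @mwiden n A) (@polyC _)) => [c|i] /=.
  by rewrite mwidenC muniC.
by rewrite mwidenX mnmwiden1 muniX_widen.
Qed.

Lemma mpoly_of_polyK : cancel mpoly_of_poly (@muni n A).
Proof.
elim/poly_ind => [|p c IH]; first by rewrite !rmorph0.
by rewrite rmorphD rmorphM !rmorphD !rmorphM /= IH horner_morphX [X in _ + muni X]horner_morphC
  muniX_max muni_mwiden.
Qed.

End MpolyIso.

(** Each variable adds one to the flat dimension. Coherence is not inherited by polynomial rings in
    general, so stable coherence supplies it anew for each number of variables. *)
Lemma mpoly_fdim (A : comNzRingType) N : stably_coherent A ->
  (forall K : lmodType A, fdim_le K N) ->
  forall n, mcoherent {mpoly A[n]} /\ forall K : lmodType {mpoly A[n]}, fdim_le K (n + N).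
Proof.
move=> [/coherent_mcoherent cohA cohX] fdA; elim=> [|n [coh IH]].
  (* Stable coherence speaks of [A] and of at least one variable; for no variables coherence is
     carried over from [A]. *)
  have loc : is_localization (@mpolyC 0 A) (eq 1).
    apply: isloc_bij => [c c' /eqP | p]; first by rewrite mpolyC_eq => /eqP.
    exists p@_0%MM; apply/mpolyP => m; have -> : m = 0%MM by apply/mnmP => -[].
    by rewrite mcoeffC eqxx mulr1.
  by split; [exact: isloc_mcoherent loc cohA | exact: isloc_fdim loc _ cohA fdA].
have coh1 : mcoherent {mpoly A[n.+1]} by apply/coherent_mcoherent/cohX.
split=> //.
have loc : is_localization (mpoly_of_poly A n) (eq 1).
  apply: isloc_bij; first exact: can_inj (@mpoly_of_polyK A n).
  by move=> p; exists (muni p); exact: muniK.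
have loc' : is_localization (@muni n A) (eq 1).
  apply: isloc_bij; first exact: can_inj (@muniK A n).
  by move=> p; exists (mpoly_of_poly A n p); exact: mpoly_of_polyK.
apply: (isloc_fdim loc); first exact: isloc_mcoherent loc' coh1.
exact: fdim_poly_ring coh IH.
Qed.

(** * Minimal resolutions over a local ring *)

Section QuotientModule.
Variables (R : comNzRingType).

Section Projection.
Variable I : submodClosed R^o.

Definition quot_proj_fun (x : R^o) : quotient_mod I :=
  @sqcls R R^o _ I x (isT : x \in @whole R).

Lemma quot_proj_linear : linear quot_proj_fun.
Proof.
move=> a x y; rewrite /quot_proj_fun /sqcls -(qclsZ (T := sq_premodule _ I)).
rewrite -(qclsD (T := sq_premodule _ I)); congr qcls; exact: val_inj.
Qed.

Definition quot_proj : {linear R^o -> quotient_mod I} :=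
  HB.pack quot_proj_fun (GRing.isLinear.Build R R^o (quotient_mod I) *:%R _ quot_proj_linear).

Lemma quot_proj_eq x y : quot_proj x = quot_proj y <-> x - y \in I.
Proof. exact: sqcls_eq. Qed.

Lemma quot_proj_eq0 x : quot_proj x = 0 <-> x \in I.
Proof. by rewrite -(linear0 quot_proj) quot_proj_eq subr0. Qed.

Lemma quot_proj_surj c : exists x, quot_proj x = c.
Proof.
exists (val (repr c : {x : R^o | x \in @whole R})); rewrite -[RHS]qcls_repr.
by congr qcls; apply: val_inj.
Qed.

End Projection.

Section InducedMap.
Variables (I J : submodClosed R^o) (IJ : forall x, x \in I -> x \in J).

Definition quot_map_fun (c : quotient_mod I) : quotient_mod J :=
  quot_proj J (projT1 (cid (quot_proj_surj c))).

Lemma quot_map_funE x : quot_map_fun (quot_proj I x) = quot_proj J x.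
Proof.
by rewrite /quot_map_fun; case: cid => y /= /quot_proj_eq/IJ h; apply/quot_proj_eq.
Qed.

Lemma quot_map_linear : linear quot_map_fun.
Proof.
move=> a c d; have [x <-] := quot_proj_surj c; have [y <-] := quot_proj_surj d.
by rewrite -linearP !quot_map_funE linearP.
Qed.

Definition quot_map : {linear quotient_mod I -> quotient_mod J} :=
  HB.pack quot_map_fun
    (GRing.isLinear.Build R (quotient_mod I) (quotient_mod J) *:%R _ quot_map_linear).

Lemma quot_mapE x : quot_map (quot_proj I x) = quot_proj J x.
Proof. exact: quot_map_funE. Qed.

End InducedMap.

Lemma scale_linear (K : lmodType R) (a : R) : linear (fun x : K => a *: x).
Proof. by move=> b x y; rewrite scalerDr !scalerA mulrC. Qed.

Lemma fdim_quotient_regular (I J : submodClosed R^o) (a : R) n :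
  (forall z : R^o, a *: z \in I -> z \in I) ->
  (forall z : R^o, z \in J <-> exists w : R^o, z - a *: w \in I) ->
  fdim_le (quotient_mod I) n -> fdim_le (quotient_mod J) n.+1.
Proof.
move=> reg JE h.
have IJ x : x \in I -> x \in J by move=> xI; apply/JE; exists 0; rewrite scaler0 subr0.
pose f : {linear quotient_mod I -> quotient_mod I} := HB.pack (fun x => a *: x)
  (GRing.isLinear.Build R _ _ _ _ (@scale_linear (quotient_mod I) a)).
have fE x : f (quot_proj I x) = quot_proj I (a *: x) by rewrite linearZ.
have f_inj : injective f.
  move=> c d; have [x <-] := quot_proj_surj c; have [y <-] := quot_proj_surj d.
  by rewrite !fE => /quot_proj_eq; rewrite -scalerBr => /reg/quot_proj_eq.
refine (@fdim_le_quotient R _ _ _ f (quot_map IJ) f_inj _ _ _ h (fdim_leS h)); last first.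
  by move=> c; have [x <-] := quot_proj_surj c; exists (quot_proj I x); rewrite quot_mapE.
move=> c; have [x <-] := quot_proj_surj c; rewrite quot_mapE quot_proj_eq0 JE.
split=> [[w h'] | [d]].
  by exists (quot_proj I w); rewrite fE; apply/esym/quot_proj_eq.
have [w <-] := quot_proj_surj d; rewrite fE => /esym/quot_proj_eq h'.
by exists w.
Qed.

Lemma eflat_bij (K L : lmodType R) (f : {linear K -> L}) :
  injective f -> (forall y, exists x, f x = y) -> eflat K -> eflat L.
Proof.
move=> f_inj f_surj flK p q D y yD.
have [x xE] : exists x, vmap f x = y by apply: vmap_surj.
rewrite -xE; apply: relation_comb_map; apply: flK.
apply/ffunP => j; apply: f_inj; move/ffunP/(_ j): yD.
by rewrite -xE -vmap_mul ffunE => ->; rewrite !ffunE linear0.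
Qed.

Lemma fdim_quotient0 (I : submodClosed R^o) : (forall x : R^o, x \in I -> x = 0) ->
  fdim_le (quotient_mod I) 0.
Proof.
move=> I0; apply: (eflat_bij (f := quot_proj I)); last exact: eflat_ring.
  by move=> x y /quot_proj_eq/I0/eqP; rewrite subr_eq0 => /eqP.
exact: quot_proj_surj.
Qed.

End QuotientModule.

Section LocalRing.
Variables (T : comNzRingType).

Definition nonunit (t : T) : Prop := ~ exists u, u * t = 1.

Lemma nonunitMl a t : nonunit t -> nonunit (a * t).
Proof. by move=> h [u uE]; apply: h; exists (u * a); rewrite -mulrA. Qed.

Lemma nonunit0 : nonunit 0.
Proof. by move=> [u] /eqP; rewrite mulr0 eq_sym oner_eq0. Qed.

(** Over a local ring this says that the rows of [D] generate their span minimally. *)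
Definition minimal_mx p q (D : 'M[T]_(p, q)) : Prop :=
  forall u : 'rV_p, u *m D = 0 -> forall i, nonunit (u 0 i).

Lemma exists_minimal_mx p q (D : 'M[T]_(p, q)) :
  exists p' (D' : 'M_(p', q)),
    [/\ minimal_mx D', exists W, D' = W *m D & exists W, D = W *m D'].
Proof.
elim: p D => [|p IH] D.
  exists 0%N, D; split; first by move=> u _ [].
    by exists 1%:M; rewrite mul1mx.
  by exists 1%:M; rewrite mul1mx.
case: (pselect (minimal_mx D)) => [mD|].
  by exists p.+1, D; split=> //; exists 1%:M; rewrite mul1mx.
move=> /existsNP[u /not_implyP[uD /existsNP[i /contrapT[t tu]]]].
have [p' [D' [mD' [W WE] [W' W'E]]]] := IH (row' i D).
exists p', D'; split=> //.
  exists (W *m rowsub (lift i) 1%:M); rewrite WE -mulmxA; congr (_ *m _).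
  by rewrite mul_rowsub_mx mul1mx; apply/matrixP => j l; rewrite !mxE.
(* [Z] recovers all rows from the remaining ones; row i is the combination read off from the
   relation [u], divided by its coefficient at i. *)
pose Z := \matrix_(j < p.+1, l < p)
  if unlift i j is Some k then (k == l)%:R else - (t * u 0 (lift i l)).
exists (Z *m W'); rewrite -mulmxA -W'E; apply/matrixP => j l; rewrite mxE.
under eq_bigr do rewrite !mxE.
case: (unliftP i j) => [k ->|->].
  rewrite (bigD1 k) //= eqxx mul1r big1 ?addr0 // => s /negPf sk.
  by rewrite eq_sym sk mul0r.
move/rowP/(_ l): uD; rewrite !mxE (bigD1_ord i) //= => /(congr1 (fun z => t * z)).
rewrite mulr0 mulrDr mulrA tu mul1r => /eqP; rewrite addr_eq0 => /eqP ->.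
by rewrite mulr_sumr -sumrN; apply: eq_bigr => s _; rewrite mulNr mulrA.
Qed.

Lemma exists_minimal_exact p q (D : 'M[T]_(p, q)) : mcoherent T ->
  exists k (U : 'M_(k, p)), mexact U D /\ minimal_mx U.
Proof.
move=> coh; have [k [U [UD ex]]] := coh _ _ D.
have [k' [U' [mU' [W WE] [W' W'E]]]] := exists_minimal_mx U.
exists k', U'; split=> //; split; first by rewrite WE -mulmxA UD mulmx0.
by move=> u /ex[v ->]; exists (v *m W'); rewrite -mulmxA -W'E.
Qed.

Lemma minimal_entries p q k (D : 'M[T]_(p, q)) (U : 'M_(k, p)) :
  minimal_mx D -> U *m D = 0 -> forall i j, nonunit (U i j).
Proof.
move=> mD UD i j; have := mD (row i U) _ j; rewrite mxE; apply.
by rewrite -row_mul UD row0.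
Qed.

(* The cokernel of D has a minimal free resolution of length at most n + 1. *)
Fixpoint finite_res n p q (D : 'M[T]_(p, q)) : Prop :=
  if n is n'.+1 then
    exists k (U : 'M_(k, p)), [/\ mexact U D, minimal_mx U & finite_res n' U]
  else forall u : 'rV_p, u *m D = 0 -> u = 0.

(** After [j] syzygies no rows remain: coker [D] has a free resolution whose term in degree j + 1 is
    zero. *)
Fixpoint short_res j p q (D : 'M[T]_(p, q)) : Prop :=
  if j is j'.+1 then exists k (U : 'M_(k, p)), mexact U D /\ short_res j' U
  else p = 0%N.

Definition single (K : lmodType T) p (i : 'I_p) (x : K) : {ffun 'I_p -> K} :=
  [ffun j => if j == i then x else 0].

Lemma vmul_single (K : lmodType T) p q (D : 'M_(p, q)) i (x : K) :
  (forall j, D i j *: x = 0) -> vmul (single i x) D = 0.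
Proof.
move=> h; apply/ffunP => j; rewrite !ffunE big1 // => l _; rewrite ffunE.
by case: eqP => [->|_]; rewrite ?scaler0 ?h.
Qed.

(** The differentials of a minimal resolution act as zero on [K], so Tor has no nonzero boundaries,
    and its vanishing forces the free module in that degree to be zero. *)
Lemma residue_finite_res (K : lmodType T) (e : K) n p q (D : 'M[T]_(p, q)) :
  mcoherent T -> e != 0 -> (forall t (x : K), nonunit t -> t *: x = 0) ->
  minimal_mx D -> tor_vanish K n.+1 D -> finite_res n D.
Proof.
move=> coh e0 Km; elim: n p q D => [|n IH] p q D mD h; last first.
  have [k [U [UD mU]]] := exists_minimal_exact D coh.
  by exists k, U; split=> //; apply: IH => //; apply: h.
have [k [U [UD mU]]] := exists_minimal_exact D coh.
move=> u /UD.2[v ->]; case: k => [|k] in U UD mU v *.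
  by rewrite (_ : v = 0) ?mul0mx //; apply/rowP => -[].
have [|l [V [z [VU zE]]]] := h _ _ UD (single 0 e).
  by apply: vmul_single => j; apply/Km/(minimal_entries mD UD.1).
case/eqP: e0; move/ffunP/(_ 0): zE; rewrite !ffunE eqxx => ->.
by rewrite big1 // => i _; apply/Km/(minimal_entries mU VU).
Qed.

Lemma short_res_empty j p (U : 'M[T]_(0, p)) : short_res j U.
Proof.
elim: j p U => [|j IH] p U //=; exists 0%N, 0; split=> //.
by split=> [|u _]; [rewrite mul0mx | exists 0; apply/rowP => -[]].
Qed.

(** An injective differential with nonunit entries and at least one row would give a nonzero Tor
    class: an element w killed by all entries, placed in one coordinate, is a cycle, while no
    nonzero relations exist to make it a boundary. *)
Lemma finite_res_short (K : lmodType T) n j p q (D : 'M[T]_(p, q)) :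
  (forall (I : finType) (c : I -> T), (forall i, nonunit (c i)) ->
     exists2 w : K, w != 0 & forall i, c i *: w = 0) ->
  (forall i j, nonunit (D i j)) -> minimal_mx D -> finite_res n D ->
  (forall i, (j <= i)%N -> tor_vanish K i D) -> short_res j D.
Proof.
move=> depth0; elim: j n p q D => [|j IH] n p q D Dm mD resD torD.
  have base p' q' (D' : 'M[T]_(p', q')) : (forall i j, nonunit (D' i j)) ->
      vexact K D' -> (forall u : 'rV_p', u *m D' = 0 -> u = 0) -> p' = 0%N.
    case: p' D' => [//|p'] D' D'm vD' D'inj.
    have [|w w0 wE] := depth0 _ (fun ij : 'I_p'.+1 * 'I_q' => D' ij.1 ij.2).
      by move=> [i l]; apply: D'm.
    have [|l [V [z [VD zE]]]] := vD' (single 0 w).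
      by apply: vmul_single => l; apply: (wE (0, l)).
    case/eqP: w0; move/ffunP/(_ 0): zE; rewrite !ffunE eqxx => ->.
    suff -> : V = 0 by rewrite big1 // => i _; rewrite mxE scale0r.
    apply/row_matrixP => i; rewrite row0; apply: D'inj.
    by rewrite -row_mul VD row0.
  (* The resolution is shortened from its far end: once the last free module is zero, the map before
     it is injective. *)
  elim: n p q D Dm mD resD torD => [|n IHn] p q D Dm mD resD torD.
    exact: base Dm (torD 0%N isT) resD.
  have [k [U [UD mU resU]]] := resD.
  apply: base Dm (torD 0%N isT) _ => u /UD.2[v ->].
  have k0 : k = 0%N.
    apply: (IHn _ _ U) => //; first exact: minimal_entries mD UD.1.
    by move=> i _; apply: (torD i.+1).
  by rewrite (_ : v = 0) ?mul0mx //; apply/rowP => -[i ik]; exfalso; move: ik; rewrite k0.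
case: n resD => [Dinj | n [k [U [UD mU resU]]]].
  exists 0%N, 0; split; last exact: short_res_empty.
  by split=> [|u /Dinj ->]; [rewrite mul0mx | exists 0; rewrite mul0mx].
exists k, U; split=> //; apply: (IH n) => //; first exact: minimal_entries mD UD.1.
by move=> i ji; apply: (torD i.+1).
Qed.

End LocalRing.

(** * Weak proregularity and the top Koszul degree *)

Section Tower.
Variables (T : comNzRingType) (k : nat -> nat).
Variables (d : forall n i : nat, 'M[T]_(k i.+1, k i)) (phi : forall m n i : nat, 'M[T]_(k i)).
Hypotheses (dd : forall n i, d n i.+1 *m d n i = 0)
  (phi_d : forall m n i, (n <= m)%N -> phi m n i.+1 *m d n i = d m i *m phi m n i)
  (phi_phi : forall m n p i, (p <= n)%N -> (n <= m)%N ->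
     phi m n i *m phi n p i = phi m p i).
Variable r : nat.
Hypothesis k_top : k r.+2 = 0%N.
Hypothesis pro_exact : forall i n, (i <= r)%N -> exists2 m, (n <= m)%N &
  forall u : 'rV_(k i.+1), u *m d m i = 0 -> exists v, u *m phi m n i.+1 = v *m d n i.+1.

Lemma pro_exact_mx i n : (i <= r)%N -> exists2 m, (n <= m)%N &
  forall p (V : 'M_(p, k i.+1)), V *m d m i = 0 ->
    exists W, V *m phi m n i.+1 = W *m d n i.+1.
Proof.
move=> /pro_exact-/(_ n)[m nm h]; exists m => // p V Vd.
have [f fE] : exists f : 'I_p -> 'rV_(k i.+2),
    forall l, row l V *m phi m n i.+1 = f l *m d n i.+1.
  apply: (@exists_fun _ _ (fun l v => row l V *m phi m n i.+1 = v *m d n i.+1)) => l.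
  by apply: h; rewrite -row_mul Vd row0.
exists (\matrix_l f l); apply/row_matrixP => l.
by rewrite !row_mul rowK -fE.
Qed.

(* A chain map from the complex m to a resolution with current differential D,
   a chain map psi from the resolution to the complex n, and a homotopy h
   between their composite and phi m n, all in degree i.+1. *)
Definition factor_state m n i b b' (D : 'M[T]_(b, b')) : Prop :=
  exists (pi : 'M_(k i.+1, b)) (psi : 'M_(b, k i.+1)) (h : 'M_(k i, k i.+1))
         (psi' : 'M_(b', k i)),
    [/\ d m i.+1 *m pi *m D = 0, psi *m d n i = D *m psi' &
        (phi m n i.+1 - pi *m psi - d m i *m h) *m d n i = 0].

(** The map [pi] lifts by exactness of the resolution. The maps [psi] and [h] lift only after
    composition with [phi n n'], which turns cycles of level n into boundaries of level n'; this is
    the price of one degree. *)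
Lemma factor_state_step m n n' i b b' b2 (D : 'M_(b, b')) (U : 'M_(b2, b)) :
  (n' <= n)%N -> (n <= m)%N ->
  (forall p (V : 'M_(p, k i.+1)), V *m d n i = 0 ->
     exists W, V *m phi n n' i.+1 = W *m d n' i.+1) ->
  mexact U D -> factor_state m n i D -> factor_state m n' i.+1 U.
Proof.
move=> n'n nm kill UD [pi [psi [h [psi' [piD psid hd]]]]].
have [pi2 pi2E] := mexact_lift UD piD.
have [psi2 psi2E] : exists W, U *m psi *m phi n n' i.+1 = W *m d n' i.+1.
  by apply: kill; rewrite -mulmxA psid mulmxA UD.1 mul0mx.
have [h2 h2E] := kill _ _ hd.
exists pi2, psi2, h2, (psi *m phi n n' i.+1); split.
- by rewrite -mulmxA -pi2E mulmxA dd mul0mx.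
- by rewrite -psi2E mulmxA.
rewrite !mulmxBl phi_d ?(leq_trans n'n) // -!mulmxA -psi2E -h2E.
rewrite -(phi_phi _ n'n nm) !mulmxBl !mulmxBr !mulmxA pi2E dd !mul0mx subr0.
by rewrite opprB addrA subrK subrr.
Qed.

(** Here [n] depends on n', i and j but not on [m] or [D], because the resolution belongs to level m
    and is chosen later. *)
Lemma factor_state_end j i n' : (i + j)%N = r -> exists2 n, (n' <= n)%N &
  forall m b b' (D : 'M_(b, b')), (n <= m)%N -> factor_state m n i D ->
    short_res j D -> exists h, phi m n' r.+1 = d m r *m h.
Proof.
elim: j i n' => [|j IH] i n' ijr.
  (* The resolution has run out, so pi psi = 0 and [phi - d h] takes values in the top cycles. These
     become boundaries at level n', and boundaries there vanish by [k_top]. *)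
  rewrite addn0 in ijr; rewrite ijr; have [n n'n kill] := pro_exact_mx n' (leqnn r).
  exists n => // m b b' D nm [pi [psi [h [psi' [_ _ hd]]]]] b0.
  have := kill _ _ hd; rewrite [pi *m psi](_ : _ = 0) ?subr0; last first.
    apply/matrixP => x y; rewrite !mxE big1 // => s _; exfalso.
    by case: s; rewrite b0.
  move=> [W]; rewrite [W *m _](_ : _ = 0); last first.
    apply/matrixP => x y; rewrite !mxE big1 // => s _; exfalso.
    by case: s; rewrite k_top.
  move/eqP; rewrite mulmxBl subr_eq0 phi_phi // -mulmxA => /eqP ->.
  by exists (h *m phi n n' r.+1).
have [n1 n'n1 h1] := IH i.+1 n' (etrans (addSnnS _ _) ijr).
have [|n n1n kill] := @pro_exact_mx i n1; first by rewrite -ijr leq_addr.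
exists n; first exact: leq_trans n1n.
move=> m b b' D nm st [b2 [U [UD resU]]].
apply: (h1 m _ _ U) resU; first exact: leq_trans nm.
exact: factor_state_step st.
Qed.

(** [D] and [d m 0] have the same row span, hence the same cokernel. The comparison starts with the
    identity in degree 0 and the zero homotopy. *)
Lemma tower_top n' : exists2 n, (n' <= n)%N &
  forall m b (D : 'M_(b, k 0)), (n <= m)%N -> (exists W, D = W *m d m 0) ->
    (exists W, d m 0 = W *m D) -> short_res r D ->
    exists h, phi m n' r.+1 = d m r *m h.
Proof.
have [n n'n h] := factor_state_end n' (add0n r).
exists n => // m b D nm [W WE] [pi piE] resD; apply: h (nm) _ resD.
exists pi, (W *m phi m n 1), 0, (phi m n 0); split.
- by rewrite -mulmxA -piE dd.
- by rewrite -mulmxA phi_d // mulmxA -WE.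
rewrite mulmx0 subr0 mulmxBl phi_d // -!mulmxA phi_d // [W *m _]mulmxA -WE.
by rewrite mulmxA -piE subrr.
Qed.

End Tower.

(** * The Koszul complex in matrix form *)

Section KoszulMatrix.
Variables (R : comNzRingType) (s : nat).

Definition kset i : {set {set 'I_s}} := [set I : {set 'I_s} | #|I| == i].
Definition kdim i := #|kset i|.
Definition kval i (t : 'I_(kdim i)) : {set 'I_s} := enum_val t.

Lemma kval_card i (t : 'I_(kdim i)) : #|kval t| = i.
Proof. by have := enum_valP t; rewrite inE => /eqP. Qed.

Lemma kval_ex i (I : {set 'I_s}) : #|I| = i -> exists t : 'I_(kdim i), kval t = I.
Proof.
move=> cI; have Ii : I \in kset i by rewrite inE cI.
by exists (enum_rank_in Ii I); rewrite /kval enum_rankK_in.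
Qed.

Lemma kval_inj i : injective (@kval i).
Proof. exact: enum_val_inj. Qed.

Lemma kdim_top : kdim s.+1 = 0%N.
Proof.
apply/eqP; rewrite cards_eq0; apply/eqP/setP => I; rewrite !inE.
by apply/negbTE; rewrite neq_ltn ltnS -[X in (_ <= X)%N]card_ord max_card.
Qed.

Definition koszul_mx (a : 'I_s -> R) i : 'M[R]_(kdim i.+1, kdim i) :=
  \matrix_(t, u) \sum_(j | j \notin kval u)
     if j |: kval u == kval t then (-1) ^+ before j (kval u) * a j else 0.

Definition koszul_phi_mx (a : 'I_s -> R) m n i : 'M[R]_(kdim i) :=
  diag_mx (\row_t \prod_(j in kval t) a j ^+ (m - n)).

Definition kenc i (x : koszul_complex R s) : 'rV[R]_(kdim i) := \row_t x (kval t).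

Definition kdec i (u : 'rV[R]_(kdim i)) : koszul_complex R s :=
  [ffun I => \sum_t if kval t == I then u 0 t else 0].

Lemma kdecK i (u : 'rV[R]_(kdim i)) : kenc i (kdec u) = u.
Proof.
apply/rowP => t; rewrite mxE ffunE (bigD1 t) //= eqxx big1 ?addr0 // => w /negPf wt.
by rewrite (inj_eq (@kval_inj i)) wt.
Qed.

Lemma kdec_homogeneous i (u : 'rV[R]_(kdim i)) : koszul_homogeneous i (kdec u).
Proof.
move=> I /eqP cI; rewrite ffunE big1 // => t _; case: eqP => // tI.
by case: cI; rewrite -tI kval_card.
Qed.

Lemma kenc_inj i (x : koszul_complex R s) : koszul_homogeneous i x -> kenc i x = 0 -> x = 0.
Proof.
move=> hx x0; apply/ffunP => I; rewrite ffunE; have [cI|/hx //] := eqVneq #|I| i.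
have [t <-] := kval_ex cI; by move/rowP/(_ t): x0; rewrite !mxE.
Qed.

Lemma kenc_diff (a : 'I_s -> R) i x : kenc i (koszul_diff a x) = kenc i.+1 x *m koszul_mx a i.
Proof.
apply/rowP => u; rewrite !mxE ffunE.
under [RHS]eq_bigr do rewrite !mxE mulr_sumr.
rewrite exchange_big; apply: eq_bigr => j ju /=.
have [t tE] : exists t : 'I_(kdim i.+1), kval t = j |: kval u.
  by apply: kval_ex; rewrite cardsU1 ju kval_card.
rewrite (bigD1 t) //= tE eqxx big1 ?addr0 => [|w wt]; first by rewrite mulrC.
by rewrite -tE (inj_eq (@kval_inj _)) eq_sym (negPf wt) mulr0.
Qed.

Lemma kenc_phi (a : 'I_s -> R) m n i x :
  kenc i (koszul_phi a m n x) = kenc i x *m koszul_phi_mx a m n i.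
Proof. by apply/rowP => t; rewrite mul_mx_diag !mxE ffunE mulrC. Qed.

Lemma koszul_diff_homogeneous (a : 'I_s -> R) i x :
  koszul_homogeneous i.+1 x -> koszul_homogeneous i (koszul_diff a x).
Proof.
move=> hx I cI; rewrite ffunE big1 // => j jI.
by rewrite hx ?mulr0 // cardsU1 jI eqSS.
Qed.

Lemma beforeU1 (j l : 'I_s) (I : {set 'I_s}) : j \notin I ->
  before l (j |: I) = (before l I + (j < l))%N.
Proof.
move=> jI; rewrite /before; case: (ltnP j l) => jl.
  rewrite (_ : [set _ in _ | _] = j |: [set i in I | (i < l)%N]).
    by rewrite cardsU1 !inE (negPf jI) addnC.
  apply/setP => i; rewrite !inE; case: eqP => // ->; by rewrite jl.
rewrite addn0; apply: eq_card => i; rewrite !inE; case: eqP => // ->.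
by rewrite (negPf jI) ltnNge jl.
Qed.

Lemma koszul_diff_diff (a : 'I_s -> R) x : koszul_diff a (koszul_diff a x) = 0.
Proof.
apply/ffunP => I; rewrite !ffunE.
pose F (j l : 'I_s) : R := (-1) ^+ before j I * (-1) ^+ before l I * a j * a l * x (j |: (l |: I)).
have FC j l : F j l = F l j by rewrite /F finset.setUCA; ring.
(* The order of insertion of two indices affects only the sign, through [before l (j |: I)];
   swapping the indices cancels the terms in pairs. *)
transitivity (\sum_(p : 'I_s * 'I_s | (p.1 \notin I) && (p.2 \notin I) && (p.1 != p.2))
   (if (p.1 < p.2)%N then - F p.1 p.2 else F p.1 p.2)).
  under eq_bigr do rewrite ffunE mulr_sumr.
  rewrite pair_big_dep /=; apply: eq_big => [[j l] | [j l]] /=.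
    by rewrite !inE negb_or eq_sym andbCA andbC andbAC.
  move=> /andP[jI _]; rewrite beforeU1 // exprD /F finset.setUCA.
  by case: ltnP => _; rewrite ?expr1 ?expr0; ring.
rewrite (bigID (fun p : 'I_s * 'I_s => (p.1 < p.2)%N)) /=.
pose swap (p : 'I_s * 'I_s) := (p.2, p.1).
have swapK : involutive swap by case.
rewrite [X in _ + X](reindex_inj (inv_inj swapK)) /=.
rewrite [X in _ + X](eq_bigl (fun p => (p.1 \notin I) && (p.2 \notin I) && (p.1 != p.2)
   && (p.1 < p.2)%N)); last first.
  move=> [j l] /=; rewrite (eq_sym l j) [X in X && _]andbC.
  rewrite -leqNgt leq_eqVlt -val_eqE /=.
  by case: (j \in I); case: (l \in I) => //=; case: eqP.
rewrite -big_split big1 //= => -[j l] /= /andP[_ jl].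
by rewrite jl ltnNge (ltnW jl) /= FC addNr.
Qed.

Lemma mulmx_ext p q (A B : 'M[R]_(p, q)) : (forall u : 'rV_p, u *m A = u *m B) -> A = B.
Proof. by move=> h; apply/row_matrixP => i; rewrite !rowE. Qed.

Lemma koszul_mx_mul a i : koszul_mx a i.+1 *m koszul_mx a i = 0.
Proof.
apply: mulmx_ext => u; rewrite -[u]kdecK mulmx0 mulmxA -!kenc_diff koszul_diff_diff.
by apply/rowP => t; rewrite !mxE ffunE.
Qed.

Lemma koszul_phi_mx_diff (a : 'I_s -> R) m n i : (n <= m)%N ->
  koszul_phi_mx a m n i.+1 *m koszul_mx (pow_seq a n) i =
  koszul_mx (pow_seq a m) i *m koszul_phi_mx a m n i.
Proof.
move=> nm; apply: mulmx_ext => u; rewrite -[u]kdecK !mulmxA -kenc_phi -!kenc_diff.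
by rewrite koszul_phi_diff // kenc_phi.
Qed.

Lemma koszul_phi_mx_mul (a : 'I_s -> R) m n p i : (p <= n)%N -> (n <= m)%N ->
  koszul_phi_mx a m n i *m koszul_phi_mx a n p i = koszul_phi_mx a m p i.
Proof.
move=> pn nm; rewrite mulmx_diag; congr diag_mx; apply/rowP => t; rewrite !mxE.
rewrite -big_split; apply: eq_bigr => j _ /=; rewrite -exprD; congr (_ ^+ _).
lia.
Qed.

Lemma weakly_proregular_mx (a : 'I_s -> R) i n : weakly_proregular a -> (i < s)%N ->
  exists2 m, (n <= m)%N & forall u : 'rV_(kdim i.+1), u *m koszul_mx (pow_seq a m) i = 0 ->
    exists v, u *m koszul_phi_mx a m n i.+1 = v *m koszul_mx (pow_seq a n) i.+1.
Proof.
move=> wpr si; have [|m [nm h]] := wpr i.+1 _ n; first by rewrite si.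
exists m => // u ud; pose x := kdec u.
have xZ : x \in koszul_cycle (pow_seq a m) i.+1.
  apply/asboolP; split; first exact: kdec_homogeneous.
  apply: (@kenc_inj i); first exact/koszul_diff_homogeneous/kdec_homogeneous.
  by rewrite kenc_diff kdecK.
have := h (sqcls (koszul_boundary (pow_seq a m) i.+1) xZ).
rewrite /koszul_homology_map subquot_mapE; last exact: koszul_phi_boundary.
rewrite -[RHS](qcls0 (sq_premodule _ _)) => /sqcls_eq /=.
rewrite subr0 => /asboolP[y _ yE]; exists (kenc i.+2 y).
by rewrite -kenc_diff -yE kenc_phi kdecK.
Qed.

End KoszulMatrix.

Section KoszulLocalization.
Variables (B C : comNzRingType) (phi : {rmorphism B -> C}) (S : B -> Prop).
Hypothesis loc : is_localization phi S.
Variables (s : nat) (a : 'I_s -> B).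

Lemma map_koszul_mx n i :
  map_mx phi (koszul_mx (pow_seq a n) i) = koszul_mx (pow_seq (phi \o a) n) i.
Proof.
apply/matrixP => t u; rewrite !mxE rmorph_sum; apply: eq_bigr => j _.
by case: ifP => _; rewrite ?rmorph0 // rmorphM rmorph_sign /pow_seq rmorphXn.
Qed.

Lemma map_koszul_phi_mx m n i :
  map_mx phi (koszul_phi_mx a m n i) = koszul_phi_mx (phi \o a) m n i.
Proof.
rewrite map_diag_mx; congr diag_mx; apply/rowP => t; rewrite !mxE rmorph_prod.
by apply: eq_bigr => j _; rewrite rmorphXn.
Qed.

(** A cycle over C is a unit multiple of the image of a cycle over B. *)
Lemma weakly_proregular_loc_mx i n : weakly_proregular a -> (i < s)%N ->
  exists2 m, (n <= m)%N &
  forall u : 'rV_(kdim s i.+1), u *m koszul_mx (pow_seq (phi \o a) m) i = 0 ->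
    exists v, u *m koszul_phi_mx (phi \o a) m n i.+1 = v *m koszul_mx (pow_seq (phi \o a) n) i.+1.
Proof.
move=> wpr si; have [m nm h] := weakly_proregular_mx n wpr si.
exists m => // u; rewrite -map_koszul_mx => /(isloc_rel loc)[s' [t [_ _ [v [-> /h[w wE]]]]]].
exists (t *: map_mx phi w).
by rewrite -map_koszul_mx -map_koszul_phi_mx -!scalemxAl -!map_mxM wE.
Qed.

End KoszulLocalization.

(* The short resolution is zero in degree r.+1, so phi m n' is null-homotopic there. *)
Lemma koszul_top (T : comNzRingType) r (b : 'I_r.+1 -> T) n' :
  (forall i n, (i <= r)%N -> exists2 m, (n <= m)%N &
     forall u : 'rV_(kdim r.+1 i.+1), u *m koszul_mx (pow_seq b m) i = 0 ->
     exists v, u *m koszul_phi_mx b m n i.+1 = v *m koszul_mx (pow_seq b n) i.+1) ->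
  exists2 n, (n' <= n)%N & forall m p (D : 'M_(p, kdim r.+1 0)), (n <= m)%N ->
    (exists W, D = W *m koszul_mx (pow_seq b m) 0) ->
    (exists W, koszul_mx (pow_seq b m) 0 = W *m D) -> short_res r D ->
    exists c, \prod_j b j ^+ (m - n') = \sum_j c j * b j ^+ m.
Proof.
move=> pro; have [n n'n h] := @tower_top T (kdim r.+1)
  (fun n i => koszul_mx (pow_seq b n) i) (fun m n i => koszul_phi_mx b m n i)
  (fun n i => koszul_mx_mul _ i) (fun m n i nm => koszul_phi_mx_diff b i nm)
  (fun m n p i pn nm => koszul_phi_mx_mul b i pn nm) r (kdim_top r.+1) pro n'.
exists n => // m p D nm WD DW resD; have [H HE] := h m p D nm WD DW resD.
have [t tE] : exists t : 'I_(kdim r.+1 r.+1), kval t = [set: 'I_r.+1].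
  by apply: kval_ex; rewrite cardsT card_ord.
move/matrixP/(_ t t): HE; rewrite !mxE eqxx mulr1n tE.
rewrite (eq_bigl predT) => [->|j]; last by rewrite inE.
(* The top degree has a single basis element, the full set; the coefficient of b_j^m collects the
   entries of [H] at the sets that j completes to it. *)
exists (fun j => \sum_u if (j \notin kval u) && (j |: kval u == kval t)
  then (-1) ^+ before j (kval u) * H u t else 0).
under eq_bigr do rewrite mxE mulr_suml.
under [RHS]eq_bigr do rewrite mulr_suml.
rewrite [RHS]exchange_big; apply: eq_bigr => u _; rewrite big_mkcond; apply: eq_bigr => j _ /=.
case: (j \notin kval u) => /=; last by rewrite mul0r.
case: ifP => _; last by rewrite !mul0r.
by rewrite mulrAC.
Qed.

(** * The local ring at a prime ideal *)

Definition loc_at (R : comNzRingType) (P : prime_idealr R) : comNzRingType := loc_ring P.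

Section LocalizationAtPrime.
Variables (R : comNzRingType) (P : prime_idealr R).
Local Notation S := (prime_compl P).

Definition loc_in_fun (x : R) : loc_at P := Defs.frac S (x : R^o) 1.

Lemma loc_in_zmod_morphism : zmod_morphism loc_in_fun.
Proof.
move=> x y; have S1 : 1 \in S by exact: rpred1.
apply/(addIr (loc_in_fun y)); rewrite subrK /loc_in_fun fracD //.
by rewrite !scale1r subrK mulr1.
Qed.

Lemma loc_in_monoid_morphism : monoid_morphism loc_in_fun.
Proof.
by split=> // x y; rewrite /loc_in_fun [RHS]lr_mulE ?mulr1 //; exact: rpred1.
Qed.

Definition loc_in : {rmorphism R -> loc_at P} :=
  HB.pack loc_in_fun
    (GRing.isZmodMorphism.Build R (loc_at P) loc_in_fun loc_in_zmod_morphism)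
    (GRing.isMonoidMorphism.Build R (loc_at P) loc_in_fun loc_in_monoid_morphism).

Lemma loc_inP : is_localization loc_in (fun s => s \in S).
Proof.
have S1 : 1 \in S by exact: rpred1.
split=> // [s t | s sS | c | x].
- exact: rpredM.
- exists (Defs.frac S (1 : R^o) s); rewrite [LHS]lr_mulE //.
  apply/frac_eq; rewrite ?rpredM //; exists 1 => //.
  by rewrite !scale1r /GRing.scale /= !mulr1 mul1r.
- elim/frac_ind: c => m s sS; exists s; split=> //; exists m.
  rewrite [LHS]lr_mulE //; apply/frac_eq; rewrite ?rpredM //; exists 1 => //.
  by rewrite !scale1r mul1r.
- rewrite -[RHS](rmorph0 loc_in) => /(frac_eq _ _ S1 S1)[u uS].
  by rewrite !scale1r scaler0 => ux; exists u.
Qed.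

Lemma loc_nonunitP t : nonunit t <-> exists s x, [/\ s \notin P, x \in P & loc_in s * t = loc_in x].
Proof.
split=> [nt | [s [x [sP xP sx]]] [u ut]].
  have [s [sS [x sx]]] := isloc_frac loc_inP t; exists s, x; split=> //.
  apply/negPn/negP => xS; have [v vx] := isloc_unit loc_inP (xS : x \in S).
  by apply: nt; exists (v * loc_in s); rewrite -mulrA sx.
have [s' [s'S [y sy]]] := isloc_frac loc_inP u.
have [|w [wS]] := @isloc_ker _ _ _ _ loc_inP (s' * s - y * x).
  apply/eqP; rewrite rmorphB !rmorphM -sx -sy subr_eq0; apply/eqP.
  by rewrite mulrACA ut mulr1.
move/eqP; rewrite mulrBr subr_eq0 => /eqP e.
have : w * (y * x) \in P by rewrite !idealMr.
by rewrite -e !prime_idealrM -!(rwP orP) => -[|[]]; apply/negP.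
Qed.

Lemma loc_nonunitD t u : nonunit t -> nonunit u -> nonunit (t + u : loc_at P).
Proof.
move=> /loc_nonunitP[s [x [sP xP sx]]] /loc_nonunitP[s' [y [s'P yP sy]]].
apply/loc_nonunitP; exists (s * s'), (s' * x + s * y); split.
- by rewrite prime_idealrM negb_or sP.
- by rewrite rpredD // idealMr.
by rewrite rmorphD !rmorphM -sx -sy; ring.
Qed.

Lemma loc_nonunit_sum (I : Type) (s : seq I) (Q : pred I) (F : I -> loc_at P) :
  (forall i, Q i -> nonunit (F i)) -> nonunit (\sum_(i <- s | Q i) F i).
Proof.
by move=> h; elim/big_ind: _ => //; [exact: nonunit0 | exact: loc_nonunitD].
Qed.

(** The witness is the residue field, the quotient by the ideal of nonunits. *)
Lemma loc_residue_module : exists (K : lmodType (loc_at P)) (e : K),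
  e != 0 /\ forall t (x : K), nonunit t -> t *: x = 0.
Proof.
pose M : {pred (loc_at P)^o} := fun t => `[< nonunit (t : loc_at P) >].
have Msub : submod_closed M.
  split; first exact/asboolP/nonunit0.
  move=> c x y /asboolP hx /asboolP hy; apply/asboolP/loc_nonunitD => //.
  exact: nonunitMl.
pose I : submodClosed (loc_at P)^o :=
  HB.pack M (GRing.isSubmodClosed.Build (loc_at P) (loc_at P)^o M Msub).
exists (quotient_mod I), (quot_proj I (1 : loc_at P)); split.
  by apply/eqP => /quot_proj_eq0/asboolP; apply; exists 1; rewrite mulr1.
move=> t x ht; have [y <-] := quot_proj_surj x; rewrite -linearZ_LR.
by apply/quot_proj_eq0/asboolP; rewrite /GRing.scale /= mulrC; apply: nonunitMl.
Qed.

End LocalizationAtPrime.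

(** * Minimal primes *)

Section MinimalPrime.
Variables (R : comNzRingType) (J : R -> Prop).
Hypotheses (J0 : J 0) (JD : forall x y, J x -> J y -> J (x + y)) (JM : forall a x, J x -> J (a * x))
  (J1 : ~ J 1).

(** [P] is the complement of a multiplicative set maximal among those disjoint from [J]. The second
    clause is minimality over [J] in elementwise form: elements of [P] become nilpotent modulo [J]
    after localization at [P]. *)
Lemma exists_minimal_prime : exists P : prime_idealr R,
  (forall x, J x -> x \in P) /\
  forall x, x \in P -> exists s k, s \notin P /\ J (s * x ^+ k).
Proof.
pose Q (W : set R) := (forall x y, W x -> W y -> W (x * y)) /\ forall x, W x -> ~ J x.
have [A [[AM AJ] Amax]] : exists A, Q A /\ forall B, (A `<` B)%classic -> ~ Q B.
  apply: Zorn_bigcup => F FQ tot; split=> [x y [X FX Xx] [Y FY Yy] | x [X FX Xx]].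
    by case: (tot _ _ FX FY) => h; [exists Y => //; apply: (FQ _ FY).1 => //; apply: h
      | exists X => //; apply: (FQ _ FX).1 => //; apply: h].
  exact: (FQ _ FX).2.
have A1 : A 1.
  apply: contrapT => nA1; apply: (Amax (fun x => A x \/ x = 1)).
    by split=> [x Ax|]; [left | move=> /(_ 1) h; apply/nA1/h; right].
  split=> [x y [Ax|->] [Ay|->] | x [/AJ //|-> //]]; rewrite ?mul1r ?mulr1; by [left; auto | right].
have AX x k : A x -> A (x ^+ k) by move=> Ax; elim: k => // k IH; rewrite exprS; apply: AM.
(* Otherwise the products s x^k with s in [A] would form a larger multiplicative set disjoint from
   [J]. *)
have AP x : ~ A x -> exists s k, A s /\ J (s * x ^+ k).
  move=> nAx; apply: contrapT => h.
  apply: (Amax (fun y => exists s k, A s /\ y = s * x ^+ k)).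
    split=> [y Ay|]; first by exists y, 0%N; rewrite mulr1.
    by move=> /(_ x) h'; apply/nAx/h'; exists 1, 1%N; rewrite mul1r.
  split=> [_ _ [s [k [As ->]]] [t [l [At ->]]] | _ [s [k [As ->]]] Js].
    by exists (s * t), (k + l)%N; split; [exact: AM | rewrite exprD mulrACA].
  by apply: h; exists s, k.
pose p : R -> bool := fun x => `[< ~ A x >].
have pN x : x \notin (p : {pred R}) <-> A x.
  by rewrite -[_ \in _]/(p x); split=> [/asboolPn/contrapT|h] //; apply/asboolPn; apply.
have pI : idealr_closed (p : {pred R}).
  split.
  - by apply/asboolP => /AJ; apply.
  - exact/pN.
  move=> a x y /asboolP/AP[s [k [As Jx]]] /asboolP/AP[t [l [At Jy]]].
  apply/asboolP => Axy.
  (* The exponent k + l makes every binomial term divisible by x^k or by y^l. *)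
  apply: (AJ (s * t * (a * x + y) ^+ (k + l))); first by apply/AM; [exact: AM | exact: AX].
  rewrite exprDn mulr_sumr; elim/big_ind: _ => // i _.
  rewrite mulrnAr -mulr_natl; apply: JM; case: (leqP l i) => li.
    rewrite -(subnK li) exprD.
    rewrite (_ : _ * _ = s * (a * x) ^+ (k + l - (i - l + l)) * y ^+ (i - l) * (t * y ^+ l)).
      exact: JM.
    by ring.
  have -> : (k + l - i = (l - i) + k)%N by lia.
  rewrite exprD exprMn exprMn.
  rewrite (_ : _ * _ = t * a ^+ (l - i) * x ^+ (l - i) * a ^+ k * y ^+ i * (s * x ^+ k)).
    exact: JM.
  by ring.
have pP : prime_idealr_closed (p : {pred R}).
  move=> x y /asboolP nAxy; apply: contrapT => /negP; rewrite negb_or.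
  by move=> /andP[/pN Ax /pN Ay]; apply/nAxy/AM.
pose PI : prime_idealr R := HB.pack p (isIdealr.Build R p pI) (isPrimeIdealrClosed.Build R p pP).
exists PI; split=> [x Jx | x /asboolP/AP[s [k [As Jx]]]].
  by apply/asboolP => /AJ; apply.
by exists s, k; split=> //; apply/pN.
Qed.

End MinimalPrime.

(** * Vanishing of the top Cech cohomology *)

Section CechVanishing.
Variables (R : comNzRingType).

Lemma frac_sum (S : mulrClosed R) (M : lmodType R) (I : Type) (l : seq I) (Q : pred I)
    (F : I -> M) s : s \in S ->
  \sum_(i <- l | Q i) Defs.frac S (F i) s = Defs.frac S (\sum_(i <- l | Q i) F i) s.
Proof.
move=> sS; elim: l => [|i l IH].
  by rewrite !big_nil -[0 in RHS](scale0r (0 : M)) -fracZ scale0r.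
rewrite !big_cons IH; case: (Q i) => //; rewrite fracD // -scalerDr; apply/frac_eq; rewrite ?rpredM //.
by exists 1; [exact: rpred1 | rewrite !scalerA !mulrA].
Qed.

Lemma loc_map_scale (S T : mulrClosed R) (M : lmodType R) b (x : locm S M) :
  (forall s, s \in S -> exists c, c * s \in T) -> loc_map T (b *: x) = b *: loc_map T x.
Proof.
move=> ST; pose f : {linear locm S M -> locm T M} := HB.pack (@loc_map R S T M)
  (GRing.isLinear.Build R (locm S M) (locm T M) *:%R _ (loc_map_linear (M := M) ST)).
exact: (linearZ_LR f).
Qed.

Variables (r : nat) (a : 'I_r.+1 -> R) (P : prime_idealr R).

(** A top cochain is one fraction u / [PT]^n. Multiplied by s it becomes the sum of the u c_j a_j^m
    / [PT]^m, and each term comes from the localization that omits a_j. *)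
Lemma cech_top_vanish :
  (forall n, exists m s c, [/\ (n <= m)%N, s \notin P &
     s * \prod_j a j ^+ (m - n) = \sum_j c j * a j ^+ m]) ->
  forall x : locm (prime_compl P) (cech_cohomology a r.+1), x = 0.
Proof.
move=> top x; rewrite -(frac_num_den x); have := den_in x.
move: (num x) (den x) => w s0 s0P.
suff [s sP sw] : exists2 s, s \notin P & s *: w = 0.
  rewrite -[RHS](scale0r (Defs.frac (prime_compl P) (0 : cech_cohomology a r.+1) s0)) fracZ scale0r.
  by apply/frac_eq => //; exists s => //; rewrite scalerA mulrC -scalerA sw !scaler0.
rewrite -(qcls_repr w); move: (repr w) => [z zZ].
pose PT := \prod_(j in [set: 'I_r.+1]) a j.
have [zh _] := asboolP _ zZ.
have /asboolP[n zn] := den_in (z [set: 'I_r.+1]).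
have := frac_num_den (z [set: 'I_r.+1]); rewrite zn.
move: (num _) => u zT.
have [m [s [c [nm sP top_eq]]]] := top n; exists s => //.
rewrite -(qclsZ (T := sq_premodule _ _)).
(* At most one term occurs, as I determines the omitted j. The sign is chosen to cancel that of the
   Cech differential. *)
pose y : cech a := fun I => \sum_(j | I == [set: 'I_r.+1] :\ j)
  (-1) ^+ before j [set: 'I_r.+1] *:
  Defs.frac (cech_den a I) (u * c j : R^o) ((\prod_(l in I) a l) ^+ m).
have y0 (I : {set 'I_r.+1}) : #|I| != r -> y I = 0.
  move=> cI; rewrite /y [LHS]big_pred0 // => j; apply/negbTE; apply: contra cI => /eqP ->.
  by have := cardsD1 j [set: 'I_r.+1]; rewrite cardsT card_ord inE add1n => -[<-].
have yT j : y ([set: 'I_r.+1] :\ j) = (-1) ^+ before j [set: 'I_r.+1] *: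
    Defs.frac (cech_den a ([set: 'I_r.+1] :\ j)) (u * c j : R^o)
      ((\prod_(l in [set: 'I_r.+1] :\ j) a l) ^+ m).
  rewrite /y (eq_bigl (pred1 j)) ?big_pred1_eq // => l /=.
  apply/eqP/eqP => [/setP/(_ j)|-> //]; rewrite !inE eqxx /= => /esym/negbT.
  by rewrite andbT negbK => /eqP.
have powS (I : {set 'I_r.+1}) : (\prod_(l in I) a l) ^+ m \in cech_den a I by apply/asboolP; exists m.
apply: etrans (qcls0 (sq_premodule (@cech_cocycle R _ a r.+1) (@cech_coboundary R _ a r.+1))).
apply/qclsP; rewrite /= /sq_eqv /= subr0; apply/asboolP; exists y; first by move=> I; rewrite eqSS; apply: y0.
apply: mod_prodP => K; rewrite mod_prodZ /cech_diff.
have ST j t : j \in K -> t \in cech_den a (K :\ j) -> exists c, c * t \in cech_den a K.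
  exact: cech_den_dvd.
have [KT | KT] := eqVneq K [set: 'I_r.+1]; last first.
  have cK : #|K| != r.+1.
    apply: contra KT => /eqP cK; rewrite eqEcard finset.subsetT cardsT card_ord cK leqnn //.
  rewrite zh // scaler0 big1 // => j jK; rewrite y0.
    by rewrite -(scale0r 0) loc_map_scale ?scale0r ?scaler0 // => t; apply: ST.
  by apply: contra cK => /eqP cK; rewrite (cardsD1 j) jK cK.
subst K; have PTm : PT ^+ m \in cech_den a [set: 'I_r.+1] by apply: powS.
have PTn : PT ^+ n \in cech_den a [set: 'I_r.+1] by apply/asboolP; exists n.
have PTE j : a j ^+ m * (\prod_(l in [set: 'I_r.+1] :\ j) a l) ^+ m = PT ^+ m.
  by rewrite -exprMn /PT [in RHS](big_setD1 j).
rewrite (eq_bigr (fun j => Defs.frac (cech_den a [set: 'I_r.+1])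
   (a j ^+ m *: (u * c j : R^o)) (PT ^+ m))) => [|j jT]; last first.
  rewrite yT loc_map_scale => [|t]; last exact: ST.
  rewrite scalerA -exprMn mulN1r opprK expr1n scale1r.
  by rewrite (@loc_mapE _ _ _ _ (fun t => ST j t jT) _ _ (a j ^+ m)) ?PTE.
rewrite frac_sum // -zT fracZ; apply/frac_eq => //; exists 1; first exact: rpred1.
rewrite !scale1r /GRing.scale /=.
transitivity (PT ^+ n * (u * (s * \prod_j a j ^+ (m - n)))).
  have -> : \prod_j a j ^+ (m - n) = PT ^+ (m - n).
    by rewrite prodrXl /PT; congr (_ ^+ _); apply: eq_bigl => j; rewrite inE.
  rewrite -{1}(subnK nm) exprD; ring.
rewrite top_eq; congr (_ * _); rewrite mulr_sumr [RHS]big_mkcond; apply: eq_bigr => j _.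
rewrite inE; ring.
Qed.

End CechVanishing.

(** * Parameter sequences are regular *)

Section InitialIdeals.
Variables (R : comNzRingType) (f : nat -> R).

(** Indexing by natural numbers lets all initial segments share one sequence; [ext_seq] brings
    finite sequences into this form. *)
Definition init_ideal i : {pred R^o} :=
  fun z => `[< exists c : nat -> R, z = \sum_(j < i) c j * f j >].

Lemma init_ideal_submod i : submod_closed (init_ideal i).
Proof.
split; first by apply/asboolP; exists (fun=> 0); rewrite big1 // => j _; rewrite mul0r.
move=> a _ _ /asboolP[c ->] /asboolP[d ->]; apply/asboolP.
exists (fun j => a * c j + d j); rewrite [_ *: _]mulr_sumr -big_split /=.
by apply: eq_bigr => j _; rewrite mulrDl mulrA.
Qed.
HB.instance Definition _ i :=
  GRing.isSubmodClosed.Build R R^o (init_ideal i) (init_ideal_submod i).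

Lemma init_idealMl i a z : z \in init_ideal i -> a * z \in init_ideal i.
Proof. exact: (@rpredZ _ _ (init_ideal i) a). Qed.

Lemma init_ideal0 z : z \in init_ideal 0 -> z = 0.
Proof. by move=> /asboolP[c ->]; rewrite big_ord0. Qed.

Lemma init_idealS i z : z \in init_ideal i.+1 <-> exists w, z - f i * w \in init_ideal i.
Proof.
split=> [/asboolP[c ->] | [w /asboolP[c zE]]].
  by exists (c i); apply/asboolP; exists c; rewrite big_ord_recr /= mulrC addrK.
apply/asboolP; exists (fun j => if j == i then w else c j).
rewrite big_ord_recr /= eqxx [w * _]mulrC; apply/(addIr (- (f i * w))); rewrite addrK zE.
by apply: eq_bigr => j _; rewrite ltn_eqF.
Qed.

Lemma mem_init_ideal i j : (j < i)%N -> f j \in init_ideal i.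
Proof.
move=> ji; apply/asboolP; exists (fun l => (l == j)%:R).
rewrite (bigD1 (Ordinal ji)) //= eqxx mul1r big1 ?addr0 // => l /negPf lj.
by rewrite -val_eqE /= in lj; rewrite lj mul0r.
Qed.

Definition regular_upto i : Prop :=
  forall j, (j < i)%N -> forall z, f j * z \in init_ideal j -> z \in init_ideal j.

Lemma fdim_init_ideal i : regular_upto i -> fdim_le (quotient_mod (init_ideal i)) i.
Proof.
elim: i => [|i IH] reg.
  exact/fdim_quotient0/init_ideal0.
apply: (@fdim_quotient_regular R (init_ideal i) _ (f i)).
- by move=> z; apply: reg.
- exact: init_idealS.
by apply: IH => j ji; apply: reg; apply: leqW.
Qed.

End InitialIdeals.

Lemma init_ideal_ext (R : comNzRingType) (f g : nat -> R) i :
  (forall j, (j < i)%N -> f j = g j) -> init_ideal f i =i init_ideal g i.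
Proof.
move=> fg z; apply/asboolP/asboolP => -[c ->]; exists c; apply: eq_bigr => j _.
  by rewrite fg.
by rewrite fg.
Qed.

Section LocalizedIdeals.
Variables (B C : comNzRingType) (phi : {rmorphism B -> C}) (S : B -> Prop).
Hypothesis loc : is_localization phi S.
Variable f : nat -> B.

Lemma isloc_cancel_ideal i s (x : C) : S s -> phi s * x \in init_ideal (phi \o f) i ->
  x \in init_ideal (phi \o f) i.
Proof.
move=> /(isloc_unit loc)[t ts] /(init_idealMl t).
by rewrite mulrA ts mul1r.
Qed.

Lemma isloc_init_ideal i z : phi z \in init_ideal (phi \o f) i <->
  exists s, S s /\ s * z \in init_ideal f i.
Proof.
split=> [/asboolP[c zE] | [s [Ss /asboolP[c szE]]]]; last first.
  apply: (isloc_cancel_ideal Ss); apply/asboolP; exists (phi \o c).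
  by rewrite -rmorphM szE rmorph_sum; apply: eq_bigr => j _; rewrite rmorphM.
have [s [Ss [g gE]]] := isloc_common_frac loc (fun j : 'I_i => c j).
pose g' j := if insub j is Some j' then g j' else 0.
have g'E (j : 'I_i) : g' j = g j by rewrite /g' valK.
have [|t [St]] := isloc_ker loc (x := s * z - \sum_(j < i) g' j * f j).
  rewrite rmorphB rmorphM zE mulr_sumr rmorph_sum -sumrB big1 // => j _.
  by rewrite rmorphM g'E -gE mulrA subrr.
rewrite mulrBr => /eqP; rewrite subr_eq0 => /eqP h.
exists (t * s); split; first exact: (islocM loc).
apply/asboolP; exists (fun j => t * g' j); rewrite -mulrA h mulr_sumr.
by apply: eq_bigr => j _; rewrite mulrA.
Qed.

Lemma isloc_regular i : regular_upto f i -> regular_upto (phi \o f) i.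
Proof.
move=> reg j ji x h; have [s [Ss [z sz]]] := isloc_frac loc x.
apply: (isloc_cancel_ideal Ss); rewrite sz; apply/isloc_init_ideal.
have : phi (f j * z) \in init_ideal (phi \o f) j.
  by rewrite rmorphM -sz mulrCA; apply: init_idealMl.
move/isloc_init_ideal => [t [St ht]]; exists t; split=> //.
by apply: (reg _ ji); rewrite mulrCA.
Qed.

End LocalizedIdeals.

(** The elements are treated one at a time: multiply by the largest power of c that does not kill.
    Elements treated before still kill the product. *)
Lemma common_killed (T : comNzRingType) (K : lmodType T) (w : K) (l : seq T) :
  w != 0 -> (forall c, c \in l -> exists k, c ^+ k *: w = 0) ->
  exists g, g *: w != 0 /\ forall c, c \in l -> c *: (g *: w) = 0.
Proof.
move=> w0; elim: l => [|c l IH] h; first by exists 1; rewrite scale1r.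
have [|g [gw0 gP]] := IH; first by move=> c' c'l; apply: h; rewrite inE c'l orbT.
have ex : exists k, c ^+ k *: (g *: w) == 0.
  have [|k kE] := h c; first by rewrite inE eqxx.
  by exists k; rewrite scalerA mulrC -scalerA kE scaler0.
case: (ex_minnP ex) => -[|k] /eqP kE kmin; first by rewrite scale1r in kE; rewrite kE eqxx in gw0.
exists (c ^+ k * g); rewrite -scalerA; split.
  by apply/negP => /kmin; rewrite ltnn.
move=> c'; rewrite inE => /orP[/eqP ->|/gP c'0]; first by rewrite [LHS]scalerA -exprS.
by rewrite [LHS]scalerA mulrC -scalerA c'0 scaler0.
Qed.

Definition ext_seq (R : comNzRingType) s (a : 'I_s -> R) (j : nat) : R :=
  if insub j is Some j' then a j' else 0.

Lemma ext_seqE (R : comNzRingType) s (a : 'I_s -> R) (j : 'I_s) : ext_seq a j = a j.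
Proof. by rewrite /ext_seq valK. Qed.

Lemma ideal_gen_init (R : comNzRingType) s (a : 'I_s -> R) (z : R^o) :
  z \in ideal_gen a <-> z \in init_ideal (ext_seq a) s.
Proof.
split=> /asboolP[c ->]; apply/asboolP.
  exists (ext_seq c); apply: eq_bigr => j _; by rewrite !ext_seqE.
by exists (fun j => c j); apply: eq_bigr => j _; rewrite ext_seqE.
Qed.

Lemma parameter_sequence_regular (R : comNzRingType) N r (a : 'I_r.+1 -> R) :
  mcoherent R -> (forall K : lmodType R, fdim_le K N) -> parameter_sequence a ->
  regular_upto (ext_seq a) r -> regular_upto (ext_seq a) r.+1.
Proof.
move=> coh fdR [wpr _ top] reg j; rewrite ltnS leq_eqVlt => /orP[/eqP ->{j}|]; last exact: reg.
move=> z az; apply: contrapT => nz.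
pose J c := c * z \in init_ideal (ext_seq a) r.
have [] := @exists_minimal_prime R J.
- by rewrite /J mul0r rpred0.
- by move=> x y Jx Jy; rewrite /J mulrDl rpredD.
- by move=> b x Jx; rewrite /J -mulrA; apply: init_idealMl.
- by rewrite /J mul1r.
move=> P [JP Pmin].
have loc := loc_inP P; pose b := loc_in P \o a.
have aP j : a j \in P.
  apply: JP; rewrite /J -ext_seqE; case: (ltngtP j r) => [jr|rj|-> //].
    by rewrite mulrC; apply/init_idealMl/mem_init_ideal.
  by have := ltn_ord j; rewrite ltnS leqNgt rj.
have b_nonunit j : nonunit (b j).
  by apply/loc_nonunitP; exists 1, (a j); rewrite idealr1 rmorph1 mul1r.
pose f := loc_in P \o ext_seq a.
have fdT (K : lmodType (loc_at P)) : fdim_le K N by apply: isloc_fdim loc _ coh fdR K.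
have cohT := isloc_mcoherent loc coh.
pose Q : lmodType (loc_at P) := quotient_mod (init_ideal f r).
have fdQ : fdim_le Q r by exact: fdim_init_ideal (isloc_regular loc reg).
have depth0 (I : finType) (c : I -> loc_at P) : (forall i, nonunit (c i)) ->
    exists2 w : Q, w != 0 & forall i, c i *: w = 0.
  (* The class of [z] is nonzero as (I : z) lies in [P], and by [Pmin] each nonunit has a power that
     kills it. *)
  move=> cn; pose w0 : Q := quot_proj (init_ideal f r) (loc_in P z).
  have w00 : w0 != 0.
    apply/eqP => /quot_proj_eq0/(isloc_init_ideal loc)[s [sP /JP sP']].
    by move: sP; rewrite inE sP'.
  have [|g [gw gP]] := @common_killed _ _ w0 [seq c i | i : I] w00; last first.
    by exists (g *: w0) => // i; apply: gP; apply: codom_f.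
  move=> _ /codomP[i ->]; have /loc_nonunitP[s [x [sP xP sx]]] := cn i.
  have [t [k [tP tx]]] := Pmin x xP; exists k.
  rewrite -linearZ_LR; apply/quot_proj_eq0.
  have sS : t * s ^+ k \in prime_compl P by rewrite rpredM // rpredX.
  apply: (isloc_cancel_ideal loc sS).
  have -> : loc_in P (t * s ^+ k) * (c i ^+ k * loc_in P z) = loc_in P (t * x ^+ k * z).
    by rewrite !rmorphM !rmorphXn -sx exprMn !mulrA.
  by apply/(isloc_init_ideal loc); exists 1; split; [exact: rpred1 | rewrite mul1r].
have [x] := top P aP; apply/negP; rewrite negbK; apply/eqP; apply: cech_top_vanish => n'.
have [n n'n kt] := @koszul_top (loc_at P) r b n' (fun i n ir =>
  weakly_proregular_loc_mx loc n wpr (ir : (i < r.+1)%N)).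
(* The successor makes the exponent positive even if n = 0, so that the entries of the Koszul
   matrix, made from the b_j^m, are nonunits. *)
pose m := n.+1; pose D0 := koszul_mx (pow_seq b m) 0.
have [p [D [mD [W WE] W'E]]] := exists_minimal_mx D0.
have Dn i j : nonunit (D i j).
  rewrite WE mxE; apply: loc_nonunit_sum => l _; apply: nonunitMl; rewrite mxE.
  apply: loc_nonunit_sum => s _; case: ifP => _; last exact: nonunit0.
  by apply: nonunitMl; rewrite /pow_seq exprSr; apply: nonunitMl.
have [K [e [e0 Ke]]] := loc_residue_module P.
have resD : finite_res N D.
  by apply: (residue_finite_res cohT e0 Ke mD); apply: (fdim_leS (fdT K)).
have shortD : short_res r D.
  apply: (finite_res_short depth0 Dn mD resD) => i ri.
  exact: (fdim_le_trans ri fdQ).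
have [|c cE] := kt m p D (leqnSn n) _ W'E shortD; first by exists W.
(* Back to [R]: [s] clears the denominators of the coefficients, and [t] removes the difference that
   vanishes only after localization. *)
have [s [sP [g gE]]] := isloc_common_frac loc c.
have [|t [tP]] := isloc_ker loc (x := s * \prod_j a j ^+ (m - n') - \sum_j g j * a j ^+ m).
  have prodE : loc_in P (\prod_j a j ^+ (m - n')) = \prod_j b j ^+ (m - n').
    by rewrite rmorph_prod; apply: eq_bigr => j _; rewrite rmorphXn.
  rewrite rmorphB rmorphM prodE rmorph_sum cE mulr_sumr -sumrB big1 // => j _.
  by rewrite rmorphM rmorphXn -gE mulrA subrr.
rewrite mulrBr => /eqP; rewrite subr_eq0 => /eqP h.
exists m, (t * s), (fun j => t * g j); split.
- exact: (leqW n'n).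
- exact: (islocM loc tP sP).
rewrite -mulrA h mulr_sumr; apply: eq_bigr => j _; exact: mulrA.
Qed.

Lemma prefix_seq_ext (R : comNzRingType) r (a : 'I_r -> R) i (le_ir : (i <= r)%N) j :
  (j < i)%N -> ext_seq (prefix_seq a le_ir) j = ext_seq a j.
Proof.
move=> ji; rewrite -[j]/(val (Ordinal ji)) ext_seqE /prefix_seq -ext_seqE.
by [].
Qed.

(** Regularity is gained one entry at a time: strength makes the first i + 1 entries a parameter
    sequence, and the first i are regular by induction. *)
Lemma fdim_HMCM (R : comNzRingType) N :
  mcoherent R -> (forall K : lmodType R, fdim_le K N) -> HMCM R.
Proof.
move=> coh fdR r a par.
have reg i : (i <= r)%N -> regular_upto (ext_seq a) i.
  elim: i => [|i IH] ir; first by [].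
  have pre j : (j < i.+1)%N -> ext_seq (prefix_seq a ir) j = ext_seq a j by exact: prefix_seq_ext.
  have ideal_pre j : (j <= i)%N ->
      init_ideal (ext_seq (prefix_seq a ir)) j =i init_ideal (ext_seq a) j.
    by move=> ji; apply: init_ideal_ext => l lj; apply: pre; apply: leq_trans lj (leqW ji).
  have reg_pre : regular_upto (ext_seq (prefix_seq a ir)) i.
    move=> j ji z; rewrite pre ?(leqW ji) // !ideal_pre ?(ltnW ji) //.
    exact: (IH (ltnW ir)).
  move=> j ji z; rewrite -pre // -!ideal_pre //.
  exact: (parameter_sequence_regular coh fdR (par _ ir isT) reg_pre).
split=> [i x | ].
  have [z <-] := quot_proj_surj x; rewrite -linearZ_LR => /quot_proj_eq0 h.
  apply/quot_proj_eq0; move: h; rewrite !ideal_gen_init.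
  have E : init_ideal (ext_seq (prefix_seq a (ltnW (ltn_ord i)))) i =i init_ideal (ext_seq a) i.
    by apply: init_ideal_ext => l; apply: prefix_seq_ext.
  by rewrite !E -ext_seqE; apply: (reg _ (ltn_ord i)).
(* The empty sequence generates the zero ideal, which is proper as 1 is nonzero; otherwise
   properness is part of being a parameter sequence. *)
case: r a par reg => [|r] a par reg.
  exists (quot_proj (ideal_gen a) (1 : R)); apply/eqP => /quot_proj_eq0/ideal_gen_init/init_ideal0.
  by move/eqP; rewrite oner_eq0.
have [_ [x xN] _] := par _ (leqnn r.+1) isT.
exists (quot_proj (ideal_gen a) x); apply/eqP => /quot_proj_eq0/ideal_gen_init h.
case/negP: xN; apply/ideal_gen_init; move: h.
by rewrite (@init_ideal_ext _ _ (ext_seq a)) // => j; apply: prefix_seq_ext.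
Qed.

Theorem theorem4p8 (A : comNzRingType) :
  stably_coherent A -> finite_weak_dim A ->
  forall n : nat, locally_HMCM {mpoly A[n]} /\ HMCM {mpoly A[n]}.
Proof.
move=> cohA [N flA] n.
have [coh fd] := mpoly_fdim cohA (fun K => flat_dim_fdim (flA K)) n.
split=> [P|]; last exact: fdim_HMCM coh fd.
have loc := loc_inP P.
exact: fdim_HMCM (isloc_mcoherent loc coh) (isloc_fdim loc coh fd).
Qed.
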